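(* Assume that $E$ is separable, that for every $x^*\in E^*$ the weak limit $Q_\infty x^*=\text{weak-}\lim_{t\to\infty}Q_tx^*$ exists in $E$, and that $Q_\infty$ is the covariance operator of a centred Gaussian Borel measure $\mu_\infty$ on $E$. The following assertions are equivalent: (1) the Ornstein-Uhlenbeck semigroup $P$ is selfadjoint on $L^2(E,\mu_\infty)$; (2) the semigroup $S$ is $Q$-symmetric, i.e. $S(t)Q=QS^*(t)$ for all $t\ge0$.
   Context: $E$ is a real Banach space with dual $E^*$; $S=\{S(t)\}_{t\ge0}$ is a $C_0$-semigroup of bounded linear operators on $E$ with adjoint operators $S^*(t)$ on $E^*$. $H$ is a real Hilbert space with a continuous injective linear map $i:H\to E$, and $Q:=i\circ i^*\in\mathcal L(E^*,E)$ ($H$ being identified with its dual). For $t>0$, $Q_t x^*:=\int_0^t S(s)QS^*(s)x^*\,ds$ for $x^*\in E^*$. Each $Q_t$ is then also the covariance operator of a centred Gaussian Borel measure $\mu_t$ on $E$ ($\mu_0=\delta_0$). The Ornstein-Uhlenbeck semigroup is $P(t)f(x)=\int_E f(S(t)x+y)\,d\mu_t(y)$ for bounded Borel $f$; $\mu_\infty$ is invariant for it and it extends to a $C_0$-semigroup of contractions $P=\{P(t)\}_{t\ge0}$ on $L^2(E,\mu_\infty)$. A semigroup on a Hilbert space is selfadjoint if all its operators are selfadjoint. *)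

(* Defs.v *)
From HB Require Import structures.
From mathcomp Require Import all_boot all_order all_algebra.
From mathcomp Require Import all_classical all_reals all_analysis.

Set Implicit Arguments.
Unset Strict Implicit.
Unset Printing Implicit Defensive.

Import Order.TTheory GRing.Theory Num.Theory.
Import numFieldNormedType.Exports.

Local Open Scope classical_set_scope.
Local Open Scope ring_scope.

Record bounded_op (R : realType) (V W : normedModType R) := BoundedOp {
  bop_fun :> {linear V -> W};
  bop_continuous : continuous bop_fun }.

Definition dual (R : realType) (V : normedModType R) := bounded_op V R^o.

Definition bop_comp (R : realType) (U V W : normedModType R)
    (g : bounded_op V W) (f : bounded_op U V) : bounded_op U W :=
  @BoundedOp R U W [the {linear U -> W} of g \o f]
    (fun x => continuous_comp (@bop_continuous _ _ _ f x)
                              (@bop_continuous _ _ _ g (f x))).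

Definition adjoint_op (R : realType) (V W : normedModType R)
    (T : bounded_op V W) (x : dual W) : dual V := bop_comp x T.

Definition separable (T : topologicalType) :=
  exists2 A : set T, countable A & dense A.

Definition C0_semigroup (R : realType) (E : normedModType R)
    (S : R -> bounded_op E E) :=
  [/\ forall x, S 0 x = x,
      forall s t : R, 0 <= s -> 0 <= t -> forall x, S (s + t) x = S s (S t x)
    & forall x, S t x @[t --> 0^'+] --> x].

(* [ip] is an inner product inducing the norm of [H], which is thus a real
   Hilbert space. *)
Definition hilbert_inner (R : realType) (H : completeNormedModType R)
    (ip : H -> H -> R) :=
  [/\ forall h k, ip h k = ip k h,
      forall (a : R) (h k l : H), ip (a *: h + k) l = a * ip h l + ip k l
    & forall h, ip h h = `|h| ^+ 2].

(* By the Riesz theorem, the unique h with [h, k] = x (i k) for all k: the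
   adjoint of i after the identification of H with its dual. *)
Definition hilbert_adjoint (R : realType) (E : normedModType R)
    (H : completeNormedModType R)
    (ip : H -> H -> R) (i : bounded_op H E) (x : dual E) : H :=
  get [set h | forall k, ip h k = x (i k)].

Definition factor_cov (R : realType) (E : normedModType R)
    (H : completeNormedModType R)
    (ip : H -> H -> R) (i : bounded_op H E) (x : dual E) : E :=
  i (hilbert_adjoint ip i x).

Definition borel (T : topologicalType) := g_sigma_algebraType (@open T).

Section bochner.
Context d (T : measurableType d) (R : realType) (E : normedModType R).
Variables (mu : {measure set T -> \bar R}) (D : set T).

Definition simple_vfun (phi : T -> E) :=
  [/\ finite_set (range phi), forall y, measurable (phi @^-1` [set y])
    & forall y, y != 0 -> (mu (D `&` phi @^-1` [set y]) < +oo)%E].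

Definition simple_vint (phi : T -> E) : E :=
  \sum_(y \in range phi) fine (mu (D `&` phi @^-1` [set y])) *: y.

(* The a.e. convergence is strong measurability of [f]; without it the second
   condition would only bound a lower integral of the norm. *)
Definition is_bochner_integral (f : T -> E) (v : E) :=
  exists phi : nat -> T -> E,
    [/\ forall n, simple_vfun (phi n),
        {ae mu, forall s, D s -> phi n s @[n --> \oo] --> f s},
        (\int[mu]_(s in D) `|f s - phi n s|%:E)%E @[n --> \oo] --> 0%E
      & simple_vint (phi n) @[n --> \oo] --> v].
End bochner.

Definition weak_limit (R : realType) (E : normedModType R)
    (f : R -> E) (v : E) :=
  forall y : dual E, y (f t) @[t --> +oo] --> (y v : R^o).

(* N(0, s^2); [normal_prob] is not the Dirac mass for s = 0. *)
Definition centred_normal (R : realType) (s : R) (A : set R) : \bar R :=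
  if s == 0 then \d_(0 : R) A else normal_prob 0 s A.

Definition centred_gaussian (R : realType) (E : normedModType R)
    (mu : probability (borel E) R) :=
  forall x : dual E, exists s : R, forall A : set (measurableTypeR R),
    measurable A -> mu (x @^-1` A) = centred_normal s A.

Definition covariance_operator (R : realType) (E : normedModType R)
    (mu : probability (borel E) R) (Q : dual E -> E) :=
  forall x y : dual E, y (Q x) = \int[mu]_z (x z * y z).

Definition ou_fun (R : realType) (E : normedModType R)
    (S : R -> bounded_op E E) (mu : R -> probability (borel E) R)
    (t : R) (f : borel E -> R) (x : E) : R :=
  \int[mu t]_y f (S t x + y).

Section L2.
Context d (T : measurableType d) (R : realType) (mu : probability T R).

(* Elements of [LspaceType2 mu] are a.e.-classes, coerced to functions by the
   choice of a representative. *)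
Definition L2 := LspaceType2 mu.

Definition L2inner (F G : L2) : R := \int[mu]_x (F x * G x).

Definition L2norm (F : L2) : R := fine ('N[mu]_2%:E [EFin \o F]).

Definition L2dist (F G : L2) : R := fine ('N[mu]_2%:E [EFin \o (F \- G)]).

(* [LspaceType2 mu] has no library vector space structure: [K] ranges over the
   elements of L^2 that represent [a F + G]. *)
Definition L2linear (A : L2 -> L2) :=
  forall (a : R) (F G K : L2),
    ae_eq mu setT K (fun x => a * F x + G x) ->
    ae_eq mu setT (A K) (fun x => a * A F x + A G x).

Definition L2_C0_contraction_semigroup (P : R -> L2 -> L2) :=
  [/\ forall t : R, 0 <= t -> L2linear (P t),
      forall t : R, 0 <= t -> forall F, L2norm (P t F) <= L2norm F,
      forall F, P 0 F = F,
      forall s t : R, 0 <= s -> 0 <= t -> forall F, P (s + t) F = P s (P t F)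
    & forall F, L2dist (P t F) F @[t --> 0^'+] --> (0 : R)].

Definition L2_selfadjoint_semigroup (P : R -> L2 -> L2) :=
  forall t : R, 0 <= t -> forall F G, L2inner (P t F) G = L2inner F (P t G).
End L2.

(* [P] is the C_0-semigroup of contractions on L^2(E, nu) that extends the
   Ornstein-Uhlenbeck semigroup on bounded Borel functions. *)
Definition ou_semigroup (R : realType) (E : normedModType R)
    (S : R -> bounded_op E E) (mu : R -> probability (borel E) R)
    (nu : probability (borel E) R) (P : R -> L2 nu -> L2 nu) :=
  L2_C0_contraction_semigroup P /\
  forall t : R, 0 <= t -> forall f : borel E -> R,
    measurable_fun setT f -> (exists M : R, forall x, `|f x| <= M) ->
    forall F : L2 nu, ae_eq nu setT F f ->
      ae_eq nu setT (P t F) (ou_fun S mu t f).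

(* Main.v *)
Require Import Defs.
From HB Require Import structures.
From mathcomp Require Import finmap.
From mathcomp Require Import all_boot all_order all_algebra.
From mathcomp Require Import all_classical all_reals all_analysis.
From mathcomp Require Import measurable_realfun.
From mathcomp Require Import ring lra.
Import Order.TTheory GRing.Theory Num.Theory.
Import numFieldNormedType.Exports HBNNSimple.

Set Implicit Arguments.
Unset Strict Implicit.
Unset Printing Implicit Defensive.

Local Open Scope classical_set_scope.
Local Open Scope ring_scope.

(** Write [b(x, y) = y (Q x)] and [c(x, y) = y (Q_oo x)]; both forms are
    symmetric, [b] because [Q = i i^*] and [c] because it is the covariance
    of [mu_oo]. The proof passes through a third condition,

      (3)  [c(S^*(t) x, y) = c(x, S^*(t) y)]  for all [t >= 0], [x], [y].

    Self-adjointness is (3). On the functions [cos (x + th)] the semigroup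
    acts explicitly: [P(t) cos (x + th)] is
    [exp (- x(Q_t x) / 2) cos (x S(t) + th)], by the characteristic function
    of a Gaussian variable. With the identity
    [Q_oo = Q_t + S(t) Q_oo S^*(t)], which also encodes the invariance of
    [mu_oo], the scalar product of [P(t) cos (x + th)] with [cos (y + et)] is
    [1/2 exp (- (c(x, x) + c(y, y)) / 2)] times
    [cos (th + et) exp (- c(S^*(t) x, y)) + cos (th - et) exp (c(S^*(t) x, y))]
    (P_trig_inner). At [th = et = pi/4] only the second exponential remains,
    so self-adjointness gives (3); conversely (3) makes the expression
    symmetric in the two functions, and self-adjointness on L^2 follows as
    trigonometric functions are total there (L2_functional_eq). Totality is
    proved in the form of an induction principle (sq_integrable_trig_ind):
    the sets whose indicator is a bounded pointwise limit of trigonometric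
    polynomials form a pi-system, which generates the Borel sets because, in
    a separable space, Hahn-Banach makes every closed ball an intersection of
    countably many half-spaces.

    Condition (3) is the Q-symmetry of S. If [S(t) Q = Q S^*(t)] then [S(t)]
    intertwines in the same way with the integrand [S(s) Q S^*(s)] of [Q_r],
    hence with [Q_r] and, in the limit, with [Q_oo] (Q_to_Qoo_symmetric).
    Conversely (3) passes to [Q_t = Q_oo - S(t) Q_oo S^*(t)] for every [t], so
    that the integrals over [0, t] of the gap
    [r |-> b(S^*(s) S^*(r) x, S^*(r) y) - b(S^*(r) x, S^*(s) S^*(r) y)] vanish
    and the gap is null almost everywhere. As [S^*] need not be strongly
    continuous, the gap need not be continuous at [0]. It is however the
    diagonal of a function of two times, obtained by using [S^*(u) x] and
    [S^*(v) y], that is right-continuous in each of them. Replacing [y] by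
    [S^*(q) y] for rational [q] shows that this function vanishes on whole
    half-lines, and one-sided limits in each variable carry the value [0] to
    the origin (Qoo_to_Q_symmetric). *)

(** * Hahn-Banach and norming functionals *)

Section sublinear.
Context {R : realType} {E : normedModType R}.
Implicit Types (p : E -> R) (a x y : E).

Definition sublinear p :=
  (forall x y, p (x + y) <= p x + p y) /\
  (forall c x, 0 <= c -> p (c *: x) <= c * p x).

Lemma sublinear0 p : sublinear p -> p 0 = 0.
Proof.
move=> [pD pZ]; have := pZ 0 0 (lexx _); have := pD 0 0.
rewrite scaler0 addr0 mul0r; lra.
Qed.

Lemma sublinearN_ge p x : sublinear p -> - p (- x) <= p x.
Proof. by move=> sp; have := sp.1 x (- x); rewrite subrr sublinear0//; lra. Qed.

(** The largest sublinear functional below [p] whose value at [- a] is at most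
    [- p a]. *)
Definition flatten_along p a x :=
  inf [set p (x + t *: a) - t * p a | t in [set t | 0 <= t]].

(** [t * p a <= p (t *: a) <= p (x + t *: a) + p (- x)]. *)
Lemma flatten_along_lb p a x : sublinear p ->
  lbound [set p (x + t *: a) - t * p a | t in [set t | 0 <= t]] (- p (- x)).
Proof.
move=> sp _ [t /= t0 <-]; have := sp.1 (x + t *: a) (- x).
rewrite addrAC subrr add0r.
have [->|tn0] := eqVneq t 0.
  by rewrite scale0r sublinear0// mul0r; lra.
have tp : 0 < t by rewrite lt_def tn0.
have := sp.2 t^-1 (t *: a); rewrite invr_ge0 => /(_ t0).
rewrite scalerA mulVf// scale1r ler_pdivlMl//; lra.
Qed.

Lemma flatten_along_le p a x t : sublinear p -> 0 <= t ->
  flatten_along p a x <= p (x + t *: a) - t * p a.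
Proof.
move=> sp t0; apply: ge_inf; last by exists t.
by eexists; apply: flatten_along_lb.
Qed.

Lemma le_flatten_along p a x m :
  (forall t, 0 <= t -> m <= p (x + t *: a) - t * p a) ->
  m <= flatten_along p a x.
Proof.
move=> h; apply: lb_le_inf; first by eexists; exists 0; rewrite /= ?lexx.
by move=> _ [t /= t0 <-]; apply: h.
Qed.

Lemma flatten_along_id p a x : sublinear p -> flatten_along p a x <= p x.
Proof.
by move=> sp; have := flatten_along_le a x sp (lexx _); rewrite scale0r addr0 mul0r subr0.
Qed.

Lemma flatten_alongN p a : sublinear p -> flatten_along p a (- a) <= - p a.
Proof.
move=> sp; have := flatten_along_le a (- a) sp ler01.
by rewrite scale1r addNr mul1r sublinear0// sub0r.
Qed.

Lemma sublinear_flatten_along p a : sublinear p -> sublinear (flatten_along p a).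
Proof.
move=> sp; split=> [x y|c x c0].
  rewrite -lerBlDr; apply: le_flatten_along => t t0.
  rewrite lerBlDr [leRHS]addrC -lerBlDr; apply: le_flatten_along => s s0.
  rewrite lerBlDr; apply: le_trans (flatten_along_le a _ sp (addr_ge0 s0 t0)) _.
  have := sp.1 (x + t *: a) (y + s *: a).
  rewrite (_ : x + t *: a + (y + s *: a) = x + y + (s + t) *: a); first lra.
  by rewrite scalerDl addrACA [t *: a + _]addrC.
have [->|cn0] := eqVneq c 0.
  rewrite scale0r mul0r; apply: le_trans (flatten_along_id a 0 sp) _.
  by rewrite sublinear0.
have {cn0}c0 : 0 < c by rewrite lt_neqAle eq_sym cn0.
rewrite -ler_pdivrMl//; apply: le_flatten_along => t t0.
rewrite ler_pdivrMl//.
apply: le_trans (flatten_along_le a _ sp (mulr_ge0 (ltW c0) t0)) _.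
rewrite -scalerA -scalerDr mulrBr mulrA lerB// sp.2 ?ltW//.
Qed.

(** Zorn's lemma gives a minimal sublinear functional below [p0]; flattening it
    along any vector cannot decrease it, so it is odd, and an odd sublinear
    functional is linear. *)
Lemma ex_linear_below p0 : sublinear p0 ->
  exists f : {linear E -> R^o}, forall x, f x <= p0 x.
Proof.
move=> sp0.
pose T := {p | sublinear p /\ forall x, p x <= p0 x}.
pose below (p q : T) := `[< forall x, sval q x <= sval p x >].
have t0 : T by exists p0.
have [] := @ZL_preorder T t0 below.
- by move=> t; apply/asboolP.
- move=> r s t /asboolP rs /asboolP st; apply/asboolP => x.
  exact: le_trans (st x) (rs x).
- move=> A Atot.
  have [->|/set0P[[p1 [sp1 p1le]] Ap1]] := eqVneq A set0; first by exists t0.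
  pose q x := inf [set sval p x | p in A].
  have lbA x : has_lbound [set sval p x | p in A].
    exists (- p0 (- x)) => _ [[p [sp ple]] Ap <-] /=.
    by have := sublinearN_ge x sp; have := ple (- x); lra.
  have qle (p : T) x : A p -> q x <= sval p x by move=> Ap; apply: ge_inf => //; exists p.
  have leq m x : (forall p : T, A p -> m <= sval p x) -> m <= q x.
    move=> h; apply: lb_le_inf; first by eexists; exists (exist _ p1 (conj sp1 p1le)).
    by move=> _ [p Ap <-]; apply: h.
  have sq : sublinear q.
    split=> [x y|c x c0].
      have h (p p' : T) : A p -> A p' -> q (x + y) <= sval p x + sval p' y.
        move=> Ap Ap'; have [/asboolP h|/asboolP h] := Atot _ _ Ap Ap'.
          have := (svalP p').1.1 x y; have := h x; have := qle _ (x + y) Ap'; lra.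
        have := (svalP p).1.1 x y; have := h y; have := qle _ (x + y) Ap; lra.
      have {}h (p' : T) : A p' -> q (x + y) - sval p' y <= q x.
        by move=> Ap'; apply: leq => p Ap; have := h p p' Ap Ap'; lra.
      have : q (x + y) - q x <= q y.
        by apply: leq => p' Ap'; have := h p' Ap'; lra.
      lra.
    have [->|cn0] := eqVneq c 0.
      rewrite scale0r mul0r; apply: le_trans (qle _ _ Ap1) _ => /=.
      by rewrite sublinear0.
    have cp : 0 < c by rewrite lt_def cn0.
    rewrite -ler_pdivrMl//; apply: leq => p Ap; rewrite ler_pdivrMl//.
    exact: le_trans (qle _ _ Ap) ((svalP p).1.2 _ _ c0).
  have qp0 x : q x <= p0 x by apply: le_trans (qle _ _ Ap1) (p1le x).
  by exists (exist _ q (conj sq qp0)) => s As; apply/asboolP => x /=; apply: qle.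
move=> [p [sp ple]] pmin.
have pN a : p (- a) = - p a.
  have sf := sublinear_flatten_along a sp.
  have fle x : flatten_along p a x <= p0 x.
    by apply: le_trans (flatten_along_id a x sp) (ple x).
  have h : below (exist _ p (conj sp ple)) (exist _ _ (conj sf fle)).
    by apply/asboolP => x /=; apply: flatten_along_id.
  have /asboolP/(_ (- a))/= h1 := pmin _ h.
  apply: le_anti; rewrite (le_trans h1 (flatten_alongN a sp)).
  by have := sublinearN_ge a sp; lra.
have pD x y : p (x + y) = p x + p y.
  apply: le_anti; rewrite sp.1/=.
  by have := sp.1 (x + y) (- y); rewrite addrK pN; lra.
have pZ0 c x : 0 <= c -> p (c *: x) = c * p x.
  move=> c0; apply: le_anti; rewrite sp.2//=.
  by have := sp.2 c (- x) c0; rewrite scalerN !pN; lra.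
have pZ c x : p (c *: x) = c * p x.
  have [/pZ0//|/ltW c0] := leP 0 c.
  have := @pZ0 (- c) x; rewrite oppr_ge0 scaleNr pN => /(_ c0); lra.
have plin : linear (p : E -> R^o) by move=> c x y; rewrite pD pZ.
pose L := GRing.isLinear.Build R E R^o _ (p : E -> R^o) plin.
pose f : {linear E -> R^o} := HB.pack (p : E -> R^o) L.
by exists f.
Qed.
End sublinear.

Section dual.
Context {R : realType} {E : normedModType R}.
Implicit Types (x y : dual E).

Lemma sublinear_norm : sublinear (fun z : E => `|z|).
Proof.
split=> [|c z c0]; first exact: ler_normD.
by rewrite normrZ (ger0_norm c0).
Qed.

(** Hahn-Banach: flattening the norm along [a] first makes any linear minorant
    equal to the norm at [a]. *)
Lemma ex_norming_functional (a : E) :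
  exists x : dual E, (forall z, `|x z| <= `|z|) /\ x a = `|a|.
Proof.
have [f fle] := ex_linear_below (sublinear_flatten_along a sublinear_norm).
have fnorm z : f z <= `|z|.
  exact: le_trans (fle z) (flatten_along_id a z sublinear_norm).
have fabs z : `|f z| <= `|z|.
  by rewrite ler_norml fnorm andbT lerNl -linearN -[leRHS]normrN fnorm.
have fc : continuous f.
  apply: bounded_linear_continuous; apply/linear_boundedP.
  by near=> r => z; apply: le_trans (fabs z) _; rewrite ler_peMl.
exists (BoundedOp fc); split=> //=; apply: le_anti; rewrite fnorm /=.
have := le_trans (fle (- a)) (flatten_alongN a sublinear_norm).
by rewrite linearN lerN2.
Unshelve. all: by end_near. Qed.

Lemma dual_separates (a b : E) : (forall x : dual E, x a = x b) -> a = b.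
Proof.
move=> h; have [x [_ xab]] := ex_norming_functional (a - b).
by apply/eqP; rewrite -subr_eq0 -normr_eq0 -xab linearB h subrr.
Qed.

Lemma dual_bounded x : exists2 M : R, 0 < M & forall z, `|x z : R| <= M * `|z|.
Proof.
have /linear_boundedP := continuous_linear_bounded 0 (@bop_continuous _ _ _ x 0).
move=> [r [_ rb]]; exists (Num.max r 0 + 1).
  by rewrite ltr_pwDr// le_max lexx orbT.
by move=> z; apply: rb; rewrite ltr_pwDr// le_max lexx.
Qed.

Definition dual_add x y : dual E :=
  @BoundedOp R E R^o [the {linear E -> R^o} of x \+ y]
    (fun z => continuousD (@bop_continuous _ _ _ x z) (@bop_continuous _ _ _ y z)).

Definition dual_scale (c : R) x : dual E :=
  @BoundedOp R E R^o [the {linear E -> R^o} of c \*: x]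
    (fun z => cvgZ (cvg_cst c) (@bop_continuous _ _ _ x z)).

End dual.


(** * The Riesz representation theorem *)

Section riesz.
Context {R : realType} {H : completeNormedModType R} {ip : H -> H -> R}.
Hypothesis hip : hilbert_inner ip.

Lemma ipC h k : ip h k = ip k h.
Proof. by case: hip. Qed.

Lemma ipDl h k l : ip (h + k) l = ip h l + ip k l.
Proof. by case: hip => _ ipl _; rewrite -[h in LHS]scale1r ipl mul1r. Qed.

Lemma ipZl a h k : ip (a *: h) k = a * ip h k.
Proof.
case: hip => _ ipl _; have := ipDl 0 0 k; have := ipl a h 0 k.
rewrite !addr0 => ->; lra.
Qed.

Lemma ip_normDZ h k (t : R) :
  `|h + t *: k| ^+ 2 = `|h| ^+ 2 + 2 * t * ip h k + t ^+ 2 * `|k| ^+ 2.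
Proof.
case: (hip) => _ _ ipn; rewrite -!ipn ipDl ipZl ![ip _ (_ + _)]ipC !ipDl !ipZl.
by rewrite (ipC k h); ring.
Qed.

(** The minimiser of [|h|^2 - 2 f h]: a minimising sequence is Cauchy by the
    parallelogram identity, and the first variation at the limit vanishes. *)
Lemma riesz_representation (f : dual H) : exists h, forall k, ip h k = f k.
Proof.
pose J (h : H) : R := `|h| ^+ 2 - 2 * (f h : R).
have [M M0 fM] := dual_bounded f.
pose m := inf (range J).
have Jlb : has_lbound (range J).
  exists (- M ^+ 2) => _ [h _ <-]; rewrite /J.
  have : f h <= M * `|h| by apply: le_trans (fM h); exact: ler_norm.
  have := sqr_ge0 (`|h| - M); rewrite sqrrB; lra.
have mJ h : m <= J h by apply: ge_inf => //; exists h.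
have ex_min n : exists h, J h < m + n.+1%:R^-1.
  have [||_ [h _ <-] ?] := @inf_adherent R (range J) n.+1%:R^-1.
  - by rewrite invr_gt0.
  - by split=> //; exists (J 0), 0.
  by exists h.
have [u uP] := choice ex_min.
have par h k : `|h - k| ^+ 2 = 2 * J h + 2 * J k - 4 * J (2^-1 *: h + 2^-1 *: k).
  have nh : `|2^-1 *: h + 2^-1 *: k| = 2^-1 * `|h + k|.
    by rewrite -scalerDr normrZ gtr0_norm.
  have fh : f (2^-1 *: h + 2^-1 *: k) = 2^-1 * f h + 2^-1 * f k :> R.
    by rewrite linearD !linearZ.
  rewrite /J nh fh exprMn.
  have := ip_normDZ h k 1; have := ip_normDZ h k (-1).
  rewrite scaleN1r scale1r => -> ->.
  move: (f h : R) (f k : R) (ip h k) (`|h|) (`|k|) => a b c x y; lra.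
have uclose n p : `|u n - u p| ^+ 2 <= 2 * n.+1%:R^-1 + 2 * p.+1%:R^-1.
  rewrite par; have := mJ (2^-1 *: u n + 2^-1 *: u p).
  have := uP n; have := uP p.
  move: (J (u n)) (J (u p)) (J _) n.+1%:R^-1 p.+1%:R^-1 => a b c x y; lra.
have u_cauchy : cvg (u @ \oo).
  apply/cauchy_cvgP/cauchy_exP => e e0.
  have e2 : 0 < e ^+ 2 / 4 by rewrite divr_gt0// exprn_gt0.
  near \oo => n; exists (u n).
  suff : \forall p \near \oo, ball (u n) e (u p) by [].
  near=> p.
  rewrite -ball_normE /=.
  suff : `|u n - u p| ^+ 2 < e ^+ 2 by rewrite ltr_pXn2r ?nnegrE ?normr_ge0 ?(ltW e0).
  apply: le_lt_trans (uclose n p) _.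
  have : n.+1%:R^-1 < e ^+ 2 / 4.
    by near: n; exact: (near_infty_natSinv_lt (PosNum e2)).
  have : p.+1%:R^-1 < e ^+ 2 / 4.
    by near: p; exact: (near_infty_natSinv_lt (PosNum e2)).
  move: n.+1%:R^-1 p.+1%:R^-1 => a b; lra.
pose h := lim (u @ \oo).
have uh : u n @[n --> \oo] --> h by exact: u_cauchy.
have cvgJ k : J (u n + k) @[n --> \oo] --> J (h + k).
  have uk : u n + k @[n --> \oo] --> h + k by apply: cvgD => //; exact: cvg_cst.
  apply: cvgB; last first.
    apply: cvgM; first exact: cvg_cst.
    exact: (cvg_comp _ _ uk (@bop_continuous _ _ _ f _)).
  by apply: cvgM; apply: cvg_norm.
have Jh k : J h <= J (h + k).
  apply: le_trans (mJ _).
  have J0 := cvgJ 0; rewrite addr0 in J0.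
  have m_cvg : m + n.+1%:R^-1 @[n --> \oo] --> m + 0.
    by apply: cvgD; [exact: cvg_cst|exact: cvg_harmonic].
  rewrite -[leRHS]addr0; apply: (ler_cvg_to J0 m_cvg).
  by near=> n; rewrite addr0; exact/ltW/uP.
exists h => k.
have var t : 0 <= 2 * t * (ip h k - f k) + t ^+ 2 * `|k| ^+ 2.
  have fE : f (h + t *: k) = f h + t * f k :> R by rewrite linearD linearZ.
  have := Jh (t *: k); rewrite /J ip_normDZ fE.
  move: (f h : R) (f k : R) (ip h k) (`|h|) (`|k|) => a b c x y; lra.
apply/eqP; rewrite -subr_eq0; apply/eqP.
set d := ip h k - f k in var *.
have [k0|kn0] := eqVneq (`|k| ^+ 2) 0.
  by have := var (- d); rewrite k0 mulr0 addr0; have := sqr_ge0 d; nra.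
have kp : 0 < `|k| ^+ 2 by rewrite lt_def kn0 sqr_ge0.
have := var (- d / `|k| ^+ 2).
rewrite (_ : _ + _ = - (d ^+ 2 / `|k| ^+ 2)); last first.
  by field; rewrite -sqrf_eq0.
rewrite oppr_ge0 => dle.
have : d ^+ 2 / `|k| ^+ 2 == 0.
  by rewrite eq_le dle divr_ge0 ?sqr_ge0.
by rewrite mulf_eq0 invr_eq0 (negbTE kn0) orbF sqrf_eq0 => /eqP.
Unshelve. all: by end_near. Qed.
End riesz.

(** * The characteristic function of a centred normal law *)

Section integral_tools.
Context {R : realType} d {T : measurableType d} (mu : {measure set T -> \bar R}).

Lemma Rintegral_dominated_cvg (D : set T) (f_ : nat -> T -> R) (f g : T -> R) :
  measurable D -> (forall n, measurable_fun D (f_ n)) ->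
  (forall x, D x -> f_ n x @[n --> \oo] --> f x) ->
  mu.-integrable D (EFin \o g) ->
  (forall n x, D x -> `|f_ n x| <= g x) ->
  mu.-integrable D (EFin \o f) /\
  (\int[mu]_(x in D) f_ n x)%R @[n --> \oo] --> (\int[mu]_(x in D) f x)%R.
Proof.
move=> mD mf_ ff ig fg.
have mf : measurable_fun D f.
  exact: measurable_fun_cvg mf_ ff.
have [|||||intf _ cvgf] := @dominated_convergence _ _ _ mu D mD
    (fun n => EFin \o f_ n) (EFin \o f) (EFin \o g).
- by move=> n; exact/measurable_EFinP.
- exact/measurable_EFinP.
- by apply: aeW => x Dx; apply: cvg_EFin; [exact: nearW|exact: ff].
- exact: ig.
- by apply: aeW => x n Dx; rewrite lee_fin fg.
split=> //; apply: fine_cvg; rewrite fineK //.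
exact: integrable_fin_num.
Qed.

Lemma integrable_bounded (P : {finite_measure set T -> \bar R}) (f : T -> R) (M : R) :
  measurable_fun setT f -> (forall x, `|f x| <= M) ->
  P.-integrable setT (EFin \o f).
Proof.
move=> mf fM; apply: (@le_integrable _ _ _ P _ measurableT _ (cst M%:E)).
- exact: measurableT_comp.
- move=> x _ /=; rewrite lee_fin.
  by apply: le_trans (fM x) _; exact: ler_norm.
- exact: finite_measure_integrable_cst.
Qed.

End integral_tools.

Section whole_line.
Context {R : realType}.
Local Notation leb := (@lebesgue_measure R).

(** The fundamental theorem of calculus on [- n, n], then dominated
    convergence. *)
Lemma integral_derivative_line (F f : R -> R) :
  (forall x, is_derive x (1 : R) F (f x)) -> continuous f ->
  leb.-integrable setT (EFin \o f) ->
  F n%:R - F (- n%:R) @[n --> \oo] --> 0 ->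
  \int[leb]_x f x = 0.
Proof.
move=> dF cf intf Flim.
have mf : measurable_fun setT f by exact: continuous_measurable_fun.
pose f_ (n : nat) x := f x * \1_(`[- n%:R, n%:R]%classic : set R) x.
have cvgf0 : \int[leb]_x f_ n x @[n --> \oo] --> \int[leb]_x f x.
  have [||||_ //] := @Rintegral_dominated_cvg R _ _ leb setT f_ f
    (fun x => `|f x|) measurableT.
  - by move=> n; apply: measurable_funM => //; exact: measurable_indic.
  - move=> x _; apply: cvg_near_cst; near=> n.
    rewrite /f_ indicE mem_set ?mulr1//= in_itv/= -ler_norml ltW//.
    by near: n; exact: nbhs_infty_gtr.
  - exact: integrable_norm.
  - move=> n x _; rewrite normrM ler_piMr// indicE.
    by case: (_ \in _); rewrite ?normr1 ?normr0.
apply: (cvg_unique _ cvgf0) => //.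
apply: cvg_trans Flim; apply: near_eq_cvg; near=> n.
have n0 : (0 < n%:R :> R) by rewrite ltr0n; near: n; exact: nbhs_infty_gt.
have -> : \int[leb]_x f_ n x = \int[leb]_(x in `[- n%:R, n%:R]) f x.
  rewrite [RHS]Rintegral_mkcond; apply: eq_Rintegral => x _.
  by rewrite /f_ patchE indicE; case: (_ \in _); rewrite ?mulr1 ?mulr0.
rewrite /Rintegral (@continuous_FTC2 _ f F)//=.
- by rewrite gtrN.
- exact: continuous_subspaceT.
- split=> [x _||]; first by have [] := dF x.
  + apply: cvg_at_right_filter; apply: differentiable_continuous.
    by apply/derivable1_diffP; have [] := dF (- n%:R).
  + apply: cvg_at_left_filter; apply: differentiable_continuous.
    by apply/derivable1_diffP; have [] := dF n%:R.
- by move=> x _; rewrite derive1E; have [] := dF x.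
Unshelve. all: by end_near. Qed.

End whole_line.

Section normal_law.
Context {R : realType} (s : R).
Hypothesis s0 : s != 0.
Local Notation leb := (@lebesgue_measure R).
Local Notation w := (normal_pdf 0 s).

Let s20 : Num.sqrt 2 * s != 0.
Proof. by rewrite mulf_neq0// sqrtr_eq0 -ltNge. Qed.

Let ss0 : 0 < s ^+ 2.
Proof. by rewrite exprn_even_gt0. Qed.

Lemma normal_pdf_centredE x :
  w x = normal_peak s * expR (- x ^+ 2 / (2 * s ^+ 2)).
Proof.
by rewrite normal_pdfE// /normal_fun subr0 mulr_natl.
Qed.

(** [|x| w x] is dominated by a multiple of the normal density of doubled
    variance: split the exponential into two equal factors; one of them
    absorbs [|x|] by the bound [1 + r <= exp r]. *)
Lemma normal_pdf_first_moment_bound :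
  exists2 C : R, 0 <= C &
    forall x, `|x| * w x <= C * normal_pdf 0 (Num.sqrt 2 * s) x.
Proof.
exists (normal_peak s * `|s| / normal_peak (Num.sqrt 2 * s)).
  by rewrite !mulr_ge0 ?invr_ge0 ?normal_peak_ge0.
move=> x; rewrite [in leRHS](normal_pdfE _ s20) mulrA divfK ?gt_eqF ?normal_peak_gt0//.
rewrite normal_pdf_centredE mulrCA -mulrA ler_wpM2l ?normal_peak_ge0//.
pose r := x ^+ 2 / (4 * s ^+ 2).
have -> : normal_fun 0 (Num.sqrt 2 * s) x = expR (- r).
  by congr expR; rewrite subr0 exprMn sqr_sqrtr// -mulr_natr /r; field.
have -> : - x ^+ 2 / (2 * s ^+ 2) = - r - r.
  by rewrite /r; field.
rewrite expRD mulrA ler_wpM2r ?expR_ge0// expRN ler_pdivrMr ?expR_gt0//.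
apply: (@le_trans _ _ (`|s| * (1 + r))); last first.
  by rewrite ler_wpM2l// expR_ge1Dx.
rewrite /r -(real_normK (num_real x)) -(real_normK (num_real s)).
have : 0 < `|s| by rewrite normr_gt0.
move: `|x| `|s| => a b b0.
have -> : b * (1 + a ^+ 2 / (4 * b ^+ 2)) = a + (a - 2 * b) ^+ 2 / (4 * b).
  by field; rewrite gt_eqF.
by rewrite lerDl divr_ge0 ?sqr_ge0// mulr_ge0// ltW.
Qed.

Lemma integrable_normal_first_moment :
  leb.-integrable setT (fun x => (`|x| * w x)%:E).
Proof.
have [C C0 Cb] := normal_pdf_first_moment_bound.
apply: (@le_integrable _ _ _ leb _ measurableT _
  (fun x => (C * normal_pdf 0 (Num.sqrt 2 * s) x)%:E)).
- apply/measurable_EFinP; apply: measurable_funM.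
    exact: normr_measurable.
  exact: measurable_normal_pdf.
- move=> x _; rewrite lee_fin; apply: le_trans (ler_norm _).
  by rewrite ger0_norm// mulr_ge0// normal_pdf_ge0.
- under eq_fun do rewrite EFinM.
  by apply: integrableZl => //; exact: integrable_normal_pdf.
Qed.

Lemma is_derive_normal_pdf x : is_derive x (1 : R) w (- (x / s ^+ 2) * w x).
Proof.
have -> : w = normal_peak s \*: (expR \o (- (2 * s ^+ 2)^-1 \*: (fun x => x ^+ 2))).
  apply/funext => y; rewrite normal_pdf_centredE /= /GRing.scale/=.
  by congr (_ * expR _); field.
apply: is_derive_eq; rewrite /= /GRing.scale/=.
by field.
Qed.

(** The bound on [|x| w x] makes the density vanish at infinity. *)
Lemma normal_pdf_cvg0 : w n%:R @[n --> \oo] --> 0.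
Proof.
have [C C0 Cb] := normal_pdf_first_moment_bound.
pose C' := C * normal_peak (Num.sqrt 2 * s).
have wle n : w n.+1%:R <= C' * n.+1%:R^-1.
  rewrite ler_pdivlMr// mulrC; apply: le_trans (_ : `|n.+1%:R| * w n.+1%:R <= _).
    by rewrite ger0_norm.
  by apply: le_trans (Cb _) _; rewrite ler_wpM2l// normal_pdf_ub.
rewrite -(cvg_shiftS (fun n => w n%:R)).
apply: (@squeeze_cvgr _ _ _ _ (cst 0) (fun n => C' * n.+1%:R^-1)).
- by apply: nearW => n; rewrite normal_pdf_ge0 wle.
- exact: cvg_cst.
- rewrite -[X in _ --> X](mulr0 C'); apply: cvgM; first exact: cvg_cst.
  exact: cvg_harmonic.
Qed.

Definition normal_cos (th l : R) := \int[leb]_x (cos (l * x + th) * w x).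
Definition normal_xsin (th l : R) := \int[leb]_x (- x * sin (l * x + th) * w x).

Let mcos th l : measurable_fun setT (fun x : R => cos (l * x + th)).
Proof.
apply: (measurableT_comp (f := cos)).
  by apply: continuous_measurable_fun; exact: continuous_cos.
by apply: measurable_funD => //; exact: measurable_funM.
Qed.

Let msin th l : measurable_fun setT (fun x : R => sin (l * x + th)).
Proof.
apply: (measurableT_comp (f := sin)).
  by apply: continuous_measurable_fun; exact: continuous_sin.
by apply: measurable_funD => //; exact: measurable_funM.
Qed.

Let intcos th l : leb.-integrable setT (EFin \o (fun x => cos (l * x + th) * w x)).
Proof.
apply: (@le_integrable _ _ _ leb _ measurableT _ (EFin \o w)).
- apply/measurable_EFinP; apply: measurable_funM; first exact: mcos.
  exact: measurable_normal_pdf.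
- move=> x _; rewrite lee_fin normrM ler_piMl//.
  by rewrite ler_norml cos_geN1 cos_le1.
- exact: integrable_normal_pdf.
Qed.

Let intxsin th l : leb.-integrable setT (EFin \o (fun x => - x * sin (l * x + th) * w x)).
Proof.
apply: (@le_integrable _ _ _ leb _ measurableT _ (fun x => (`|x| * w x)%:E)).
- apply/measurable_EFinP; apply: measurable_funM; last exact: measurable_normal_pdf.
  by apply: measurable_funM; [exact: oppr_measurable|exact: msin].
- move=> x _; rewrite lee_fin !normrM normr_id ler_wpM2r// normrN ler_piMr//.
  by rewrite ler_norml sin_geN1 sin_le1.
- exact: integrable_normal_first_moment.
Qed.

Let is_derive_phase (f g : R -> R) (a b x : R) :
  (forall x, is_derive x (1 : R) f (g x)) ->
  is_derive x (1 : R) (fun x => f (a * x + b)) (a * g (a * x + b)).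
Proof.
move=> dfg.
have -> : (fun x => f (a * x + b)) = f \o (a \*: id + cst b) by [].
have h : is_derive x (1 : R) (a \*: (id : R -> R) + cst b) a.
  by apply: is_derive_eq; rewrite addr0 /GRing.scale/= mulr1.
by rewrite mulrC; apply: is_derive1_comp.
Qed.

(** Differentiation under the integral sign; the first moment of the density
    is the dominating function. *)
Lemma is_derive_normal_cos th l :
  is_derive l (1 : R) (normal_cos th) (normal_xsin th l).
Proof.
pose f (l x : R) := cos (l * x + th) * w x.
have df y x : is_derive y (1 : R) (f ^~ x) (- x * sin (y * x + th) * w x).
  have -> : f ^~ x = w x \*: (fun y => cos (x * y + th)).
    by apply/funext => z; rewrite /f /= /GRing.scale/= mulrC [x * _]mulrC.
  have h := @is_derive_phase cos (fun z => - sin z) x th y (@is_derive_cos R).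
  apply: is_derive_eq; rewrite /GRing.scale/= (mulrC y x); ring.
have Il : `]l - 1, l + 1[%classic l by rewrite /= in_itv/=; lra.
have d1 y x : partial1of2 f y x = - x * sin (y * x + th) * w x.
  by rewrite /partial1of2 derive1E; have [_ ->] := df y x.
have H1 : forall y, `]l - 1, l + 1[%classic y -> leb.-integrable setT (EFin \o f y).
  by move=> y _; exact: intcos.
have H2 : forall y x, `]l - 1, l + 1[%classic y -> setT x -> derivable (f ^~ x) y 1.
  by move=> y x _ _; have [] := df y x.
have H3 x : 0 <= `|x| * w x by rewrite mulr_ge0// normal_pdf_ge0.
have H4 : forall y x, `]l - 1, l + 1[%classic y -> setT x ->
    `|partial1of2 f y x| <= `|x| * w x.
  move=> y x _ _; rewrite d1 !normrM normrN.
  rewrite (ger0_norm (normal_pdf_ge0 _ _ _)) ler_wpM2r ?normal_pdf_ge0//.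
  by rewrite ler_piMr// ler_norml sin_geN1 sin_le1.
apply: DeriveDef.
  exact: (derivable_under_integral measurableT Il H1 H2 H3
    integrable_normal_first_moment H4).
rewrite -derive1E.
rewrite (differentiation_under_integral measurableT Il H1 H2 H3
  integrable_normal_first_moment H4).
by apply: eq_Rintegral => x _; rewrite /= d1.
Qed.

(** Integration by parts, as [w' x = - (x / s^2) w x]. *)
Lemma normal_xsinE th l : normal_xsin th l = - (l * s ^+ 2) * normal_cos th l.
Proof.
pose F x := sin (l * x + th) * w x.
pose f x := l * (cos (l * x + th) * w x) + s ^- 2 * (- x * sin (l * x + th) * w x).
have dF x : is_derive x (1 : R) F (f x).
  have h1 := @is_derive_phase sin cos l th x (@is_derive_sin R).
  have h2 := is_derive_normal_pdf x.
  have -> : F = (fun x => sin (l * x + th)) * w by [].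
  by apply: is_derive_eq; rewrite /GRing.scale/= /f; field.
have intf : leb.-integrable setT (EFin \o f).
  rewrite [X in _.-integrable _ X](_ : _ = (fun x => l%:E * (cos (l * x + th) * w x)%:E +
     (s ^- 2)%:E * (- x * sin (l * x + th) * w x)%:E)%E); last by apply/funext.
  by apply: integrableD => //; apply: integrableZl => //; [exact: intcos|exact: intxsin].
have cont (g dg : R -> R) : (forall x, is_derive x (1 : R) g (dg x)) -> continuous g.
  move=> dg' x; apply: differentiable_continuous; apply/derivable1_diffP.
  by have [] := dg' x.
have cw := cont _ _ is_derive_normal_pdf.
have ccos := cont _ _ (fun x => is_derive_phase l th x (@is_derive_cos R)).
have csin := cont _ _ (fun x => is_derive_phase l th x (@is_derive_sin R)).
have cf : continuous f.
  move=> x; apply: cvgD; (apply: cvgM; first exact: cvg_cst).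
    by apply: cvgM; [exact: ccos|exact: cw].
  apply: cvgM; last exact: cw.
  by apply: cvgM; [exact: cvgN|exact: csin].
have Flim : F n%:R - F (- n%:R) @[n --> \oo] --> 0.
  have w2 : 2 * w n%:R @[n --> \oo] --> 0.
    rewrite -[X in _ --> X](mulr0 2); apply: cvgM; first exact: cvg_cst.
    exact: normal_pdf_cvg0.
  apply: (@squeeze_cvgr _ _ _ _ (fun n => - (2 * w n%:R)) (fun n => 2 * w n%:R)) => //.
    apply: nearW => n; rewrite -ler_norml; apply: le_trans (ler_normB _ _) _.
    have wN : w (- n%:R) = w n%:R by rewrite !normal_pdf_centredE sqrrN.
    rewrite /F !normrM wN (ger0_norm (normal_pdf_ge0 _ _ _)) -mulrDl.
    rewrite ler_wpM2r ?normal_pdf_ge0// -[2]/(1 + 1).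
    by rewrite lerD// ler_norml sin_geN1 sin_le1.
  by rewrite -[X in _ --> X]oppr0; apply: cvgN.
have := integral_derivative_line dF cf intf Flim.
rewrite RintegralD//; last 2 first.
- exact: (integrableZl measurableT l (intcos th l)).
- exact: (integrableZl measurableT (s ^- 2) (intxsin th l)).
rewrite (RintegralZl _ measurableT (intcos th l)).
rewrite (RintegralZl _ measurableT (intxsin th l)).
rewrite -/(normal_xsin th l) -/(normal_cos th l) => /eqP.
rewrite addrC addr_eq0 => /eqP h.
by rewrite -[LHS](mulKf (lt0r_neq0 ss0)) mulrCA h; field.
Qed.

(** The two previous lemmas say that [F' = - l s^2 F] for
    [F l = normal_cos th l], so [F l * exp (l^2 s^2 / 2)] is constant. *)
Lemma normal_cosE th l : normal_cos th l = cos th * expR (- (l ^+ 2 * s ^+ 2) / 2).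
Proof.
pose G l := normal_cos th l * expR (l ^+ 2 * s ^+ 2 / 2).
have dG y : is_derive y (1 : R) G 0.
  have h1 := is_derive_normal_cos th y.
  have -> : G = normal_cos th * (expR \o ((s ^+ 2 / 2) \*: (fun x => x ^+ 2))).
    apply/funext => z; rewrite /G !fctE /= /GRing.scale/=.
    by congr (_ * expR _); rewrite -mulrA mulrC.
  apply: is_derive_eq; rewrite /GRing.scale/= normal_xsinE.
  by move: (expR _) => e; field.
have G0 : G 0 = cos th.
  rewrite /G expr0n !mul0r expR0 mulr1 /normal_cos.
  under eq_Rintegral do rewrite mul0r add0r.
  rewrite RintegralZl//; last exact: integrable_normal_pdf.
  by rewrite /Rintegral integral_normal_pdf mulr1.
have := is_derive_0_is_cst l 0 dG; rewrite G0 /G => <-.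
by rewrite mulNr expRN mulfK// gt_eqF// expR_gt0.
Qed.
End normal_law.

Section normal_prob_integral.
Context {R : realType}.
Local Notation leb := (@lebesgue_measure R).

(** Change of variables for the Radon-Nikodym derivative, which agrees almost
    everywhere with the density. *)
Lemma Rintegral_normal_prob (s : R) (f : measurableTypeR R -> R) (M : R) :
  measurable_fun setT f -> (forall x, `|f x| <= M) ->
  \int[normal_prob 0 s]_x f x = \int[leb]_x (f x * normal_pdf 0 s x).
Proof.
move=> mf fM; rewrite /Rintegral; congr fine.
have intf : (normal_prob 0 s).-integrable setT (EFin \o f).
  exact: integrable_bounded mf fM.
rewrite -(Radon_Nikodym_change_of_variables (normal_prob_dominates 0 s))//=.
have mw : measurable_fun setT (fun x => (normal_pdf 0 s x)%:E).
  by apply/measurable_EFinP; exact: measurable_normal_pdf.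
set RN := Radon_Nikodym _ _.
have intRN : leb.-integrable setT RN.
  by apply: Radon_Nikodym_integrable; exact: normal_prob_dominates.
have mRN := measurable_int _ intRN.
apply: ae_eq_integral => //.
- by apply: emeasurable_funM => //; exact/measurable_EFinP.
- by under eq_fun do rewrite EFinM; apply: emeasurable_funM => //; exact/measurable_EFinP.
- under [in X in ae_eq _ _ _ X]eq_fun do rewrite EFinM.
  apply: ae_eqe_mul2l => /=.
  apply: integral_ae_eq => //=.
  move=> A _ mA; rewrite -Radon_Nikodym_integral//.
  exact: normal_prob_dominates.
Qed.

End normal_prob_integral.

Section centred_normal_variable.
Context {R : realType} d {T : measurableType d} (P : probability T R).
Variables (X : T -> measurableTypeR R) (s : R).
Hypothesis mX : measurable_fun setT X.
Hypothesis lawX : forall A : set (measurableTypeR R),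
  measurable A -> P (X @^-1` A) = centred_normal s A.

Lemma Rintegral_law (f : measurableTypeR R -> R) (M : R)
    (nu : probability (measurableTypeR R) R) :
  (forall A, measurable A -> P (X @^-1` A) = nu A) ->
  measurable_fun setT f -> (forall x, `|f x| <= M) ->
  \int[P]_z f (X z) = \int[nu]_x f x.
Proof.
move=> lawnu mf fM; rewrite /Rintegral; congr fine.
rewrite -(@integral_pushforward _ _ _ _ _ X mX P setT (EFin \o f))//=.
- by apply: eq_measure_integral => A mA _; exact: lawnu.
- exact/measurable_EFinP.
- by apply: (@integrable_bounded _ _ _ P _ M) => //; exact: measurableT_comp.
Qed.

(** The degenerate law [s = 0] is a Dirac mass and is treated apart. *)
Lemma centred_normal_cos (l th : R) :
  \int[P]_z cos (l * X z + th) = cos th * expR (- (l ^+ 2 * s ^+ 2) / 2).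
Proof.
have mcos : measurable_fun setT (fun x : measurableTypeR R => cos (l * x + th)).
  apply: (measurableT_comp (f := cos)).
    by apply: continuous_measurable_fun; exact: continuous_cos.
  by apply: measurable_funD => //; exact: measurable_funM.
have cosM x : `|cos (l * x + th)| <= 1.
  by rewrite ler_norml cos_geN1 cos_le1.
have [s0|s0] := eqVneq s 0.
  rewrite (Rintegral_law (M := 1) (nu := dirac (0 : measurableTypeR R)) _ mcos)//.
    rewrite /Rintegral integral_dirac//=; last exact/measurable_EFinP.
    by rewrite indicT mul1r/= mulr0 add0r s0 expr0n/= !mulr0 oppr0 mul0r expR0 mulr1.
  by move=> A mA; rewrite lawX// /centred_normal s0 eqxx.
rewrite (Rintegral_law (M := 1) (nu := normal_prob 0 s) _ mcos)//.
  by rewrite (@Rintegral_normal_prob _ s _ 1)// -normal_cosE.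
by move=> A mA; rewrite lawX// /centred_normal (negbTE s0).
Qed.

End centred_normal_variable.

Section variance.
Context {R : realType}.

Lemma derive_quotient_cvg (F : R -> R) (a : R) (t : nat -> R) :
  (forall n, t n != 0) -> t n @[n --> \oo] --> 0 -> is_derive (0 : R) (1 : R) F a ->
  (t n)^-1 * (F (t n) - F 0) @[n --> \oo] --> a.
Proof.
move=> tn0 t0 [dF <-].
have -> : (fun n => (t n)^-1 * (F (t n) - F 0)) =
    (fun n => (t n)^-1 *: ((F \o shift 0) (t n *: 1) - F 0)).
  by apply/funext => n; rewrite /= /shift/= addr0 [_%:A]mulr1.
by have /cvgr_dnbhsP/(_ t (conj tn0 t0)) := dF.
Qed.

Lemma normr_sin_le (x : R) : `|sin x| <= `|x|.
Proof.
suff h (y : R) : 0 <= y -> `|sin y| <= `|y|.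
  case: (leP 0 x) => [x0|/ltW x0]; first exact: h.
  by rewrite -normrN -sinN -(normrN x) h// oppr_ge0.
move=> y0.
have [|c _] := @MVT_segment R sin cos 0 y y0 (fun z _ => is_derive_sin z).
  by apply: continuous_subspaceT; exact: continuous_sin.
rewrite sin0 !subr0 => ->.
by rewrite normrM ler_piMl// ler_norml cos_geN1 cos_le1.
Qed.

Context d {T : measurableType d} (P : probability T R).
Variables (X : T -> measurableTypeR R) (s : R).
Hypothesis mX : measurable_fun setT X.
Hypothesis lawX : forall A : set (measurableTypeR R),
  measurable A -> P (X @^-1` A) = centred_normal s A.

(** [2 m^2 (1 - cos (X / m))] tends to [X^2] from below; its mean
    [2 m^2 (1 - exp (- s^2 / (2 m^2)))] is known from the characteristic
    function.  Fatou's lemma first gives integrability. *)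
Lemma centred_normal_variance :
  P.-integrable setT (EFin \o (fun z => X z * X z)) /\
  \int[P]_z (X z * X z) = s ^+ 2.
Proof.
pose t (n : nat) : R := n.+1%:R^-1.
have tn0 n : t n != 0 by rewrite invr_eq0 pnatr_eq0.
have t_cvg0 : t n @[n --> \oo] --> 0 by exact: cvg_harmonic.
pose f n z : R := 2 * (t n ^- 2 * (1 - cos (t n * X z + 0))).
have fE n z : f n z = ((t n)^-1 * (2 * sin (t n * (X z / 2)))) ^+ 2.
  have -> : f n z = 2 * t n ^- 2 * (1 - cos ((t n * (X z / 2)) *+ 2)).
    rewrite /f addr0 mulrA; congr (_ * (1 - cos _)).
    by rewrite -mulr_natr; field.
  by rewrite cos_mulr2n cos2sin2 -mulr_natr; field.
have f_cvg z : f n z @[n --> \oo] --> X z * X z.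
  have dF : is_derive (0 : R) (1 : R) (fun u : R => 2 * sin (u * (X z / 2))) (X z).
    have -> : (fun u : R => 2 * sin (u * (X z / 2))) =
        2 \*: (sin \o ((X z / 2) \*: (id : R -> R))).
      by apply/funext => u; rewrite /= /GRing.scale/= [_ * (X z / 2)]mulrC.
    by apply: is_derive_eq; rewrite /= /GRing.scale/= mulr0 cos0; field.
  have := derive_quotient_cvg tn0 t_cvg0 dF.
  rewrite mul0r sin0 mulr0; under eq_fun do rewrite subr0.
  move=> h; under eq_fun do rewrite fE expr2.
  exact: cvgM.
have fle n z : 0 <= f n z <= X z * X z.
  rewrite fE sqr_ge0/= -expr2.
  rewrite -[leRHS]real_normK ?num_real// -[leLHS]real_normK ?num_real//.
  rewrite ler_pXn2r ?nnegrE//.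
  rewrite normrM normfV mulrC ler_pdivrMr ?normr_gt0//.
  rewrite normrM ger0_norm// -ler_pdivlMl//.
  apply: le_trans (normr_sin_le _) _.
  by rewrite !normrM (@ger0_norm _ 2^-1)// mulrC [ `|X z| / 2]mulrC mulrA.
have mphase n : measurable_fun setT (fun z => cos (t n * X z + 0)).
  apply: (measurableT_comp (f := cos)).
    by apply: continuous_measurable_fun; exact: continuous_cos.
  by apply: measurable_funD => //; exact: measurable_funM.
have mf n : measurable_fun setT (f n).
  by apply: measurable_funM => //; apply: measurable_funM => //; exact: measurable_funB.
have intcos n : P.-integrable setT (EFin \o (fun z => cos (t n * X z + 0))).
  apply: (@integrable_bounded _ _ _ P _ 1) => // z.
  by rewrite ler_norml cos_geN1 cos_le1.
have int1cos n : P.-integrable setT (EFin \o (fun z => 1 - cos (t n * X z + 0))).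
  exact: (integrableB measurableT
    (@finite_measure_integrable_cst _ _ _ P setT 1 measurableT) (intcos n)).
have int2cos n := integrableZl measurableT (t n ^- 2) (int1cos n).
have intf n : P.-integrable setT (EFin \o f n).
  exact: (integrableZl measurableT 2 (int2cos n)).
have If n : \int[P]_z f n z = 2 * (t n ^- 2 * (1 - expR (- (t n ^+ 2 * s ^+ 2) / 2))).
  rewrite /f (RintegralZl _ measurableT (int2cos n)).
  rewrite (RintegralZl _ measurableT (int1cos n)).
  rewrite (RintegralB measurableT
    (@finite_measure_integrable_cst _ _ _ P setT 1 measurableT) (intcos n)).
  rewrite (centred_normal_cos mX lawX) cos0 mul1r.
  by rewrite Rintegral_cst//= [X in fine X]probability_setT mulr1.
have If_cvg : \int[P]_z f n z @[n --> \oo] --> s ^+ 2.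
  have t2n0 n : t n ^+ 2 != 0 by rewrite sqrf_eq0.
  have t2_cvg0 : t n ^+ 2 @[n --> \oo] --> 0.
    by rewrite -[X in _ --> X](mulr0 0); exact: cvgM.
  have dF : is_derive (0 : R) (1 : R)
      (fun u : R => - 2 * expR (- (u * s ^+ 2) / 2)) (s ^+ 2).
    have -> : (fun u : R => - 2 * expR (- (u * s ^+ 2) / 2)) =
        - 2 \*: (expR \o ((- (s ^+ 2 / 2)) \*: (id : R -> R))).
      by apply/funext => u; rewrite /= /GRing.scale/=; congr (_ * expR _); field.
    by apply: is_derive_eq; rewrite /= /GRing.scale/= mulr0 expR0; field.
  have := derive_quotient_cvg t2n0 t2_cvg0 dF.
  rewrite mul0r oppr0 mul0r expR0 => h; under eq_fun do rewrite If.
  by apply: cvg_trans h; apply: near_eq_cvg; apply: nearW => n; ring.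
have intX : P.-integrable setT (EFin \o (fun z => X z * X z)).
  have mX2 : measurable_fun setT (EFin \o (fun z => X z * X z)).
    by apply/measurable_EFinP; exact: measurable_funM.
  apply/integrableP; split=> //.
  apply: (@le_lt_trans _ _ (s ^+ 2)%:E); last exact: ltry.
  have f0 n z : setT z -> (0 <= (EFin \o f n) z)%E.
    by move=> _; rewrite lee_fin; case/andP : (fle n z).
  have := fatou P measurableT (fun n => iffRL (measurable_EFinP _ _) (mf n)) f0.
  have -> : (fun n => \int[P]_(z in setT) (EFin \o f n) z)%E =
      EFin \o (fun n => \int[P]_z f n z).
    apply/funext => n; rewrite /= /Rintegral fineK//.
    exact: (integrable_fin_num measurableT (intf n)).
  have Ie : (EFin \o (fun n => \int[P]_z f n z)) n @[n --> \oo] --> (s ^+ 2)%:E.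
    by apply: cvg_EFin; [exact: nearW|exact: If_cvg].
  rewrite (cvg_limn_einf_sup Ie).1.
  apply: le_trans; rewrite le_eqVlt; apply/orP; left; apply/eqP.
  apply: eq_integral => z _ /=.
  have h : (EFin \o (fun n => f n z)) n @[n --> \oo] --> (X z * X z)%:E.
    by apply: cvg_EFin; [exact: nearW|exact: f_cvg].
  rewrite (cvg_limn_einf_sup h).1 ger0_norm//.
  by rewrite -expr2 sqr_ge0.
split=> //.
have [||||_ h] := @Rintegral_dominated_cvg R _ _ P setT f (fun z => X z * X z)
    (fun z => X z * X z) measurableT.
- exact: mf.
- by move=> z _; exact: f_cvg.
- exact: intX.
- by move=> n z _; rewrite ger0_norm; case/andP : (fle n z).
by apply: (cvg_unique _ h If_cvg).
Qed.

End variance.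

(** * The Borel sigma-algebra of a separable Banach space *)

Section borel_measurability.
Context {R : realType}.

Lemma ex_natSinv (e : R) : 0 < e -> exists n, n.+1%:R^-1 < e.
Proof.
move=> e0; have [N _ /(_ N)/(_ (leqnn _)) h] := near_infty_natSinv_lt (PosNum e0).
by exists N.
Qed.

Lemma continuous_borelR_measurable (T : normedModType R) (f : T -> R) :
  continuous f -> measurable_fun setT (f : borel T -> measurableTypeR R).
Proof.
move=> /continuousP cf; apply: (measurability _ (RGenOpens.measurableE R)).
move=> _ [_ [a [b ->] <-]]; rewrite setTI; apply: sub_sigma_algebra.
exact/cf/interval_open.
Qed.

Context {E : normedModType R}.

Definition open_halfspaces : set (set E) :=
  [set A | exists (x : dual E) (a : R), A = [set z | x z < a]].

Lemma separable_dense_seq : separable E -> exists e : nat -> E,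
  forall z (r : R), 0 < r -> exists n, `|z - e n| < r.
Proof.
move=> [A cA dA].
have [A0|[e]] := pfcard_geP cA.
  have [z [_]] : setT `&` A !=set0.
    by apply: dA; [exists 0|exact: openT].
  by rewrite A0.
exists e => z r r0.
have [y [zy Ay]] : ball z r `&` A !=set0.
  apply: dA; first by exists z; exact: ballxx.
  exact: ball_open.
have [n _ eny] := 'surj_e Ay.
by exists n; rewrite eny; move: zy; rewrite -ball_normE.
Qed.

(** By Hahn-Banach, a closed ball is the intersection of the countably many
    closed half-spaces attached to norming functionals of a dense sequence. *)
Lemma borel_sub_halfspaces : separable E ->
  @measurable _ (borel E) `<=` <<s open_halfspaces >>.
Proof.
move=> /separable_dense_seq[e eP].
apply: smallest_sub; first exact: smallest_sigma_algebra.
pose M := g_sigma_algebraType open_halfspaces.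
suff : forall U : set E, open U -> @measurable _ M U by [].
have mhalf (x : dual E) a : @measurable _ M [set z | x z <= a].
  have -> : [set z | x z <= a] = \bigcap_n [set z | x z < a + n.+1%:R^-1].
    apply/seteqP; split=> [z /= xza n _|z /= h].
      by apply: (le_lt_trans xza); rewrite ltrDl invr_gt0.
    apply/ler_addgt0Pl => d d0; have [n] := ex_natSinv d0; have := h n I.
    by move=> /=; move: (x z : R) n.+1%:R^-1 => u v; lra.
  apply: bigcap_measurable => // n _; apply: sub_sigma_algebra.
  by exists x, (a + n.+1%:R^-1).
have [x xP] := choice (fun n => ex_norming_functional (e n)).
have mball c r : @measurable _ M [set z | `|z - c| <= r].
  have -> : [set z | `|z - c| <= r] = \bigcap_n [set z | x n z <= r + x n c].
    apply/seteqP; split=> [z /= zr n _|z /= h].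
      have [xle _] := xP n; have := xle (z - c); rewrite linearB.
      by rewrite ler_norml => /andP[_]; move: zr; rewrite /=; lra.
    apply/ler_addgt0Pl => d d0.
    have [n nd] := eP (z - c) (d / 2) (divr_gt0 d0 (ltr0Sn R 1)).
    have [xle xe] := xP n; have := xle (z - c - e n); have := h n I.
    rewrite /= !linearB /= ler_norml => hn /andP[+ _].
    have := ler_normD (z - c - e n) (e n); rewrite subrK -xe.
    move: hn nd; move: (x n z : R) (x n c : R) (x n (e n) : R) => a b k.
    lra.
  by apply: bigcap_measurable => // n _; exact: mhalf.
move=> U oU.
pose good (p : nat * nat) := [set z | `|z - e p.1| <= p.2.+1%:R^-1] `<=` U.
have -> : U = \bigcup_(p in [set p | good p]) [set z | `|z - e p.1| <= p.2.+1%:R^-1].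
  apply/seteqP; split=> [z Uz|z [p /= gp]]; last exact: gp.
  have /nbhs_ballP[d /= d0 dU] : nbhs z U by exact/open_nbhs_nbhs.
  have [k kd] := ex_natSinv (divr_gt0 d0 (ltr0Sn R 1)).
  have k0 : 0 < k.+1%:R^-1 :> R by rewrite invr_gt0.
  have [n nd] := eP z _ k0.
  exists (n, k); last exact: ltW.
  move=> y /= yk; apply: dU; rewrite -ball_normE /=.
  have := ler_normD (z - e n) (e n - y); rewrite addrA subrK (distrC (e n)).
  by move: k.+1%:R^-1 nd yk kd k0 => w; lra.
rewrite bigcup_mkcond; apply: countable_bigcupT_measurable => // p.
by case: ifP => // _; exact: mball.
Qed.

End borel_measurability.

(** * Trigonometric polynomials are dense *)

Section threshold.
Context {R : realType}.

Lemma bernoulli_ineq (y : R) n : 0 <= y -> 1 + n%:R * y <= (1 + y) ^+ n.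
Proof.
move=> y0; elim: n => [|n ih]; first by rewrite mul0r addr0 expr0.
rewrite exprS -natr1; have := mulr_ge0 (ler0n R n) (sqr_ge0 y).
have := ler_wpM2l (addr_ge0 ler01 y0) ih.
by move: (n%:R : R) ((1 + y) ^+ n) => m p; lra.
Qed.

Lemma one_sub_exp_ge (y : R) n : 0 <= y <= 1 -> 1 - n%:R * y <= (1 - y) ^+ n.
Proof.
move=> /andP[y0 y1]; elim: n => [|n ih]; first by rewrite mul0r subr0 expr0.
rewrite exprS -natr1; have := mulr_ge0 (ler0n R n) (sqr_ge0 y).
have h : 0 <= 1 - y by lra.
have := ler_wpM2l h ih.
by move: (n%:R : R) ((1 - y) ^+ n) => m p; lra.
Qed.

Lemma one_sub_exp_le (y : R) n : 0 <= y <= 1 -> (1 - y) ^+ n <= (1 + n%:R * y)^-1.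
Proof.
move=> /andP[y0 y1]; have ny0 : 0 <= n%:R * y by rewrite mulr_ge0.
rewrite -[leRHS]mul1r ler_pdivlMr; last by lra.
apply: (@le_trans _ _ ((1 - y) ^+ n * (1 + y) ^+ n)).
  by rewrite ler_wpM2l ?bernoulli_ineq// exprn_ge0//; lra.
rewrite -exprMn exprn_ile1//; nra.
Qed.

(** With [r = sqrt q], Bernoulli's inequality bounds [n r^n], and the remaining
    factor [r^n] tends to [0]. *)
Lemma cvg_natM_geometric (q : R) : 0 <= q < 1 -> n%:R * q ^+ n @[n --> \oo] --> 0.
Proof.
move=> /andP[q0 q1].
have [->|qn0] := eqVneq q 0.
  apply: cvg_near_cst; near=> n; rewrite expr0n gtn_eqF ?mulr0//.
  by near: n; exact: nbhs_infty_gt.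
pose r := Num.sqrt q.
have qp : 0 < q by rewrite lt_def qn0.
have r0 : 0 < r by rewrite sqrtr_gt0.
have r1 : r < 1 by rewrite -[ltRHS]sqrtr1 ltr_sqrt.
have d0 : 0 < r^-1 - 1 by rewrite subr_gt0 invf_gt1.
have bound n : n%:R * q ^+ n <= (r^-1 - 1)^-1 * r ^+ n.
  have -> : q = r * r by rewrite -expr2 sqr_sqrtr// ltW.
  rewrite exprMn mulrA ler_wpM2r ?exprn_ge0 ?(ltW r0)//.
  rewrite -[leRHS]mul1r ler_pdivlMr//.
  have := bernoulli_ineq n (ltW d0).
  rewrite (_ : 1 + (r^-1 - 1) = r^-1) ?exprVn; last by rewrite addrC subrK.
  move=> h.
  have rn0 : 0 < r ^+ n by rewrite exprn_gt0.
  have : n%:R * (r^-1 - 1) <= (r ^+ n)^-1 by lra.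
  by rewrite -[leRHS]mul1r ler_pdivlMr// mulrAC.
apply: (@squeeze_cvgr _ _ _ _ (cst 0) (fun n => (r^-1 - 1)^-1 * r ^+ n)).
- by apply: nearW => n; rewrite bound mulr_ge0// exprn_ge0.
- exact: cvg_cst.
- rewrite -[X in _ --> X](mulr0 (r^-1 - 1)^-1); apply: cvgM; first exact: cvg_cst.
  by apply: cvg_expr; rewrite ger0_norm ?ltW.
Unshelve. all: by end_near. Qed.

(** The polynomials [(1 - h^n)^(n 2^n)] converge on [0, 1] to the indicator of
    [h < 1/2]: by Bernoulli's inequality they are at least [1 - n (2 h)^n] and
    at most [1 / (1 + n (2 h)^n)].  The extra factor [n] in the exponent makes
    the limit at [h = 1/2] equal to [0]. *)
Lemma threshold_cvg (h : R) : 0 <= h <= 1 ->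
  (1 - h ^+ n) ^+ (n * 2 ^ n) @[n --> \oo] --> ((h < 2^-1)%R%:R : R).
Proof.
move=> /andP[h0 h1].
have hn n : 0 <= h ^+ n <= 1 by rewrite exprn_ge0//= exprn_ile1.
have kE n : (n * 2 ^ n)%:R * h ^+ n = n%:R * (2 * h) ^+ n :> R.
  by rewrite natrM natrX exprMn mulrA.
case: ltP => hh /=.
  have q1 : 0 <= 2 * h < 1 by lra.
  apply: (@squeeze_cvgr _ _ _ _ (fun n => 1 - n%:R * (2 * h) ^+ n) (cst 1)).
  - apply: nearW => n; rewrite -kE one_sub_exp_ge//= exprn_ile1//.
      by rewrite subr_ge0; case/andP : (hn n).
    by rewrite lerBlDr lerDl; case/andP : (hn n).
  - rewrite -[X in _ --> X]subr0; apply: cvgB; first exact: cvg_cst.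
    exact: cvg_natM_geometric.
  - exact: cvg_cst.
apply: (@squeeze_cvgr _ _ _ _ (cst 0) (fun n => n.+1%:R^-1)).
- apply: nearW => n; rewrite exprn_ge0 ?subr_ge0; last by case/andP : (hn n).
  apply: le_trans (one_sub_exp_le _ (hn n)) _.
  rewrite lef_pV2 ?posrE//; last first.
    by rewrite ltr_pwDl// mulr_ge0//; case/andP : (hn n).
  rewrite kE -natr1 addrC lerD2l ler_peMr// exprn_ege1//; lra.
- exact: cvg_cst.
- exact: cvg_harmonic.
Qed.

End threshold.

Section trigonometric_polynomials.
Context {R : realType} {E : normedModType R}.

Inductive trig_poly : (E -> R) -> Prop :=
| trig_cos (x : dual E) (th : R) : trig_poly (fun z => cos (x z + th))
| trig_lin (a : R) f g : trig_poly f -> trig_poly g ->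
    trig_poly (fun z => a * f z + g z).

Lemma trig_poly_eq f g : f =1 g -> trig_poly f -> trig_poly g.
Proof. by move=> /funext ->. Qed.

Lemma trig_poly0 : trig_poly (fun=> 0).
Proof.
have [x _] := ex_norming_functional (0 : E).
apply: trig_poly_eq (trig_lin (-1) (trig_cos x 0) (trig_cos x 0)) => z.
by rewrite mulN1r addNr.
Qed.

Lemma trig_polyZ a f : trig_poly f -> trig_poly (fun z => a * f z).
Proof.
move=> tf; apply: trig_poly_eq (trig_lin a tf trig_poly0) => z.
by rewrite addr0.
Qed.

Lemma trig_polyD f g : trig_poly f -> trig_poly g -> trig_poly (fun z => f z + g z).
Proof.
by move=> tf tg; apply: trig_poly_eq (trig_lin 1 tf tg) => z; rewrite mul1r.
Qed.

Lemma trig_poly_cst c : trig_poly (fun=> c).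
Proof.
have [x _] := ex_norming_functional (0 : E).
apply: trig_poly_eq (trig_polyZ c (trig_cos (dual_scale 0 x) 0)) => z.
by rewrite /= scale0r addr0 cos0 mulr1.
Qed.

Lemma cos_mul_cos (a b : R) : cos a * cos b = 2^-1 * (cos (a + b) + cos (a - b)).
Proof. by rewrite cosD cosB; field. Qed.

Lemma trig_polyM f g : trig_poly f -> trig_poly g -> trig_poly (fun z => f z * g z).
Proof.
move=> tf tg; elim: tf => [x th|a f1 f2 _ h1 _ h2]; last first.
  by apply: trig_poly_eq (trig_lin a h1 h2) => z; ring.
elim: tg => [y et|a f1 f2 _ h1 _ h2]; last first.
  by apply: trig_poly_eq (trig_lin a h1 h2) => z; ring.
have h := trig_polyD (trig_cos (dual_add x y) (th + et))
  (trig_cos (dual_add x (dual_scale (-1) y)) (th - et)).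
apply: trig_poly_eq (trig_polyZ 2^-1 h) => z.
rewrite cos_mul_cos /=; congr (_ * (cos _ + cos _)); first by ring.
by rewrite scaleN1r; ring.
Qed.

Lemma trig_polyX f n : trig_poly f -> trig_poly (fun z => f z ^+ n).
Proof.
move=> tf; elim: n => [|n ih]; first exact: trig_poly_cst.
by apply: trig_poly_eq (trig_polyM tf ih) => z; rewrite exprS.
Qed.

Lemma trig_poly_sin (x : dual E) (c a : R) : trig_poly (fun z => sin (c * (x z - a))).
Proof.
apply: trig_poly_eq (trig_cos (dual_scale c x) (- (c * a) - pi / 2)) => z /=.
rewrite -cosBpihalf; congr cos; rewrite /GRing.scale/=; ring.
Qed.

(** Sets whose indicator is a pointwise limit of [0, 1]-valued trigonometric
    polynomials; they are stable under intersection because trigonometric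
    polynomials are stable under products. *)
Definition trig_set : set (set E) := [set A | exists f : nat -> E -> R,
  [/\ forall n, trig_poly (f n), forall n z, 0 <= f n z <= 1
    & forall z, f n z @[n --> \oo] --> (\1_A z : R)]].

Lemma trig_setI : setI_closed trig_set.
Proof.
move=> A B [f [tf f01 fA]] [g [tg g01 gB]]; exists (fun n z => f n z * g n z).
split=> [n|n z|z].
- exact: trig_polyM.
- have /andP[f0 f1] := f01 n z; have /andP[g0 g1] := g01 n z.
  by rewrite mulr_ge0//= mulr_ile1.
- by rewrite indicI; apply: cvgM.
Qed.

(** Thresholding [h = (1 + sin (c (x - a))) / 2] at [1/2]. *)
Lemma trig_set_sin_lt0 (x : dual E) (c a : R) :
  trig_set [set z | sin (c * (x z - a)) < 0].
Proof.
pose h z : R := 2^-1 + 2^-1 * sin (c * (x z - a)).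
have h01 z : 0 <= h z <= 1.
  have := sin_geN1 (c * (x z - a)); have := sin_le1 (c * (x z - a)).
  by rewrite /h; move: (sin _) => u; lra.
have th : trig_poly h.
  exact: trig_polyD (trig_poly_cst _) (trig_polyZ _ (trig_poly_sin x c a)).
exists (fun n z => (1 - h z ^+ n) ^+ (n * 2 ^ n)); split=> [n|n z|z].
- apply: trig_polyX.
  apply: trig_poly_eq (trig_lin (-1) (trig_polyX n th) (trig_poly_cst 1)) => z.
  by rewrite mulN1r addrC.
- have /andP[h0 h1] := h01 z.
  rewrite exprn_ge0 ?exprn_ile1 ?subr_ge0 ?lerBlDr ?lerDl ?exprn_ge0 ?exprn_ile1//.
- have -> : \1_[set z | sin (c * (x z - a)) < 0] z = (h z < 2^-1)%R%:R :> R.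
    rewrite indicE; congr (nat_of_bool _)%:R; apply/idP/idP; rewrite inE /h /=; lra.
  exact: threshold_cvg.
Qed.

(** [u < 0] iff [sin (u / n) < 0] for all large [n], because [u / n] ends up in
    the half-period of the sine next to [0]. *)
Lemma halfspace_trig_sets (x : dual E) (a : R) :
  [set z | x z < a] =
  \bigcup_N \bigcap_(n in [set n | (N <= n)%N])
    [set z | sin (n.+1%:R^-1 * (x z - a)) < 0].
Proof.
have near_small (c : R) : 0 < c -> exists N, forall n, (N <= n)%N -> n.+1%:R^-1 < c.
  move=> c0; have [N _ h] := near_infty_natSinv_lt (PosNum c0).
  by exists N => n Nn; exact: h.
have small_pi (n : nat) (u : R) : 0 < u -> n.+1%:R^-1 < pi / u ->
    0 < sin (n.+1%:R^-1 * u).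
  move=> u0 nu; apply: sin_gt0_pi; rewrite -ltr_pdivlMr// nu andbT.
  by rewrite mulr_gt0// invr_gt0.
apply/seteqP; split=> [z /= za|z [N _] /= h].
  have u0 : 0 < a - x z by rewrite subr_gt0.
  have [N Nlt] := near_small _ (divr_gt0 (pi_gt0 R) u0).
  exists N => // n /= Nn; rewrite -opprB mulrN sinN oppr_lt0.
  exact: small_pi (Nlt n Nn).
rewrite ltNge; apply/negP; rewrite le_eqVlt => /orP[/eqP az|az].
  by have := h N (leqnn _); rewrite /= az subrr mulr0 sin0 ltxx.
have u0 : 0 < x z - a by rewrite subr_gt0.
have [N' Nlt] := near_small _ (divr_gt0 (pi_gt0 R) u0).
have := h (maxn N N') (leq_maxl _ _); rewrite /= ltNge => /negP; apply.
by apply: ltW; apply: small_pi => //; apply: Nlt; exact: leq_maxr.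
Qed.

Lemma measurable_dual (x : dual E) :
  measurable_fun setT (x : borel E -> measurableTypeR R).
Proof. by apply: continuous_borelR_measurable; exact: bop_continuous. Qed.

Lemma measurable_trig_poly (f : E -> R) : trig_poly f ->
  measurable_fun setT (f : borel E -> measurableTypeR R).
Proof.
elim=> [x th|a g h _ mg _ mh].
  apply: (measurableT_comp (f := cos)).
    by apply: continuous_measurable_fun; exact: continuous_cos.
  by apply: measurable_funD => //; exact: measurable_dual.
by apply: measurable_funD => //; exact: measurable_funM.
Qed.

Lemma borel_trig_sets : separable E -> @measurable _ (borel E) = <<s trig_set>>.
Proof.
move=> Esep; apply/seteqP; split.
  apply: subset_trans (borel_sub_halfspaces Esep) _.
  apply: smallest_sub; first exact: smallest_sigma_algebra.
  move=> _ [x [a ->]]; rewrite halfspace_trig_sets.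
  suff : @measurable _ (g_sigma_algebraType trig_set)
      (\bigcup_N \bigcap_(n in [set n | (N <= n)%N])
        [set z | sin (n.+1%:R^-1 * (x z - a)) < 0]) by [].
  apply: bigcup_measurable => N _; apply: bigcap_measurable; first by exists N => /=.
  by move=> n _; apply: sub_sigma_algebra; exact: trig_set_sin_lt0.
apply: smallest_sub; first exact: sigma_algebra_measurable.
move=> A [f [tf _ fA]].
have mA : measurable_fun setT (\1_A : borel E -> measurableTypeR R).
  apply: (@measurable_fun_cvg _ (borel E) R setT f) => [n|z _]; last exact: fA.
  exact: measurable_trig_poly.
have -> : A = (\1_A : E -> R) @^-1` [set 1].
  apply/seteqP; split=> z /=; rewrite indicE.
    by move=> Az; rewrite mem_set.
  by case: (boolP (z \in A)) => [/set_mem//|_ /esym/eqP]; rewrite oner_eq0.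
by rewrite -[X in measurable X]setTI; apply: mA => //; exact: measurable_set1.
Qed.

End trigonometric_polynomials.

Section density.
Context {R : realType}.

Definition sq_integrable d (T : measurableType d) (mu : {measure set T -> \bar R})
    (f : T -> R) :=
  measurable_fun setT f /\ mu.-integrable setT (EFin \o (fun x => f x ^+ 2)).

Lemma sq_integrable_bounded d (T : measurableType d)
    (mu : {finite_measure set T -> \bar R}) (f : T -> R) (M : R) :
  measurable_fun setT f -> (forall x, `|f x| <= M) -> sq_integrable mu f.
Proof.
move=> mf fM; split=> //; apply: (@integrable_bounded _ _ _ mu _ (M ^+ 2)).
  exact: measurable_funX.
move=> x; rewrite normrX ler_pXn2r ?nnegrE//.
exact: le_trans (fM x).
Qed.

Lemma sq_integrable_le d (T : measurableType d) (mu : {measure set T -> \bar R})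
    (f g : T -> R) : measurable_fun setT f ->
  (forall x, `|f x| <= g x) -> sq_integrable mu g -> sq_integrable mu f.
Proof.
move=> mf fg [mg ig]; split=> //; apply: le_integrable ig => //.
  by apply/measurable_EFinP; exact: measurable_funX.
move=> x _ /=; rewrite lee_fin !normrX ler_pXn2r ?nnegrE//.
exact: le_trans (fg x) (ler_norm _).
Qed.

Context {E : normedModType R} (nu : probability (borel E) R).
Variable D : (E -> R) -> Prop.
Hypotheses (Esep : separable E)
  (D_trig : forall (x : dual E) (th : R), D (fun z => cos (x z + th)))
  (D_lin : forall (a : R) f g, D f -> D g -> D (fun z => a * f z + g z))
  (D_dom : forall (f_ : nat -> E -> R) (f g : E -> R),
    (forall n, D (f_ n)) -> (forall z, f_ n z @[n --> \oo] --> f z) ->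
    sq_integrable nu (g : borel E -> R) -> (forall n z, `|f_ n z| <= g z) -> D f).

Let D_poly f : trig_poly f -> D f.
Proof. by elim=> *; [exact: D_trig|exact: D_lin]. Qed.

Let D_bounded (f_ : nat -> E -> R) (f : E -> R) :
  (forall n, D (f_ n)) -> (forall z, f_ n z @[n --> \oo] --> f z) ->
  (forall n z, `|f_ n z| <= 1) -> D f.
Proof.
move=> Df ff f1; apply: (D_dom Df ff _ f1).
by apply: (@sq_integrable_bounded _ _ _ _ 1) => // x; rewrite normr1.
Qed.

Let D_indic (A : set (borel E)) : measurable A -> D (\1_A).
Proof.
move=> mA; pose P (A : set (borel E)) := D (\1_A).
apply: (@dynkin_induction _ (borel E) trig_set P) => //.
- exact: borel_trig_sets.
- exact: trig_setI.
- by rewrite /P indicT; apply: D_poly; exact: trig_poly_cst.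
- move=> B [f [tf f01 fB]]; apply: (@D_bounded f) => //.
    by move=> n; exact: D_poly.
  by move=> n z; have /andP[f0 f1] := f01 n z; rewrite ger0_norm.
- move=> B mB PB; have := D_lin (-1) PB (D_poly (trig_poly_cst 1)).
  congr D; apply/funext => z; rewrite !indicE in_setC.
  by case: (z \in B); rewrite /= ?mulr1 ?mulr0 ?add0r ?addNr.
- move=> F mF tF PF; pose f (n : nat) z : R := \sum_(k < n) \1_(F k) z.
  have Df n : D (f n).
    elim: n => [|n ih].
      have := D_poly (trig_poly0); congr D; apply/funext => z.
      by rewrite /f big_ord0.
    have := D_lin 1 (PF n) ih; congr D; apply/funext => z.
    by rewrite /f big_ord_recr /= mul1r addrC.
  have fE n z k : F k z -> f n z = (k < n)%N%:R.
    move=> Fkz; rewrite /f; have [kn|nk] := ltnP k n.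
      rewrite (bigD1 (Ordinal kn))//= indicE mem_set// big1 ?addr0// => j jk.
      rewrite indicE memNset// => Fjz; move/negP : jk; apply; apply/eqP/val_inj => /=.
      by apply: tF => //; exists z.
    rewrite big1// => j _; rewrite indicE memNset// => Fjz.
    have jk : val j = k by apply: tF => //; exists z.
    by have := ltn_ord j; rewrite -[nat_of_ord j]/(val j) jk ltnNge nk.
  have f0 n z : ~ (\bigcup_k F k) z -> f n z = 0.
    move=> nF; rewrite /f big1// => j _; rewrite indicE memNset// => Fjz.
    by apply: nF; exists (val j).
  apply: (@D_bounded f) => // [z|n z].
    have [[k _ Fkz]|nF] := pselect ((\bigcup_k F k) z).
      rewrite indicE mem_set; last by exists k.
      apply: cvg_near_cst; near=> n; rewrite (fE n _ _ Fkz).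
      by have -> // : (k < n)%N; near: n; exact: nbhs_infty_gt.
    rewrite indicE memNset//; apply: cvg_near_cst; apply: nearW => n.
    exact: f0.
  have [[k _ Fkz]|nF] := pselect ((\bigcup_k F k) z).
    by rewrite (fE n _ _ Fkz); case: (k < n)%N; rewrite ?normr1 ?normr0.
  by rewrite f0// normr0.
- by rewrite -borel_trig_sets.
Unshelve. all: by end_near. Qed.

Let D0 : D (fun=> 0).
Proof. by apply: D_poly; exact: trig_poly0. Qed.

Let D_simple (I : Type) (r : seq I) (c : I -> R) (A : I -> set (borel E)) :
  (forall i, measurable (A i)) -> D (fun z => \sum_(i <- r) c i * \1_(A i) z).
Proof.
move=> mA; elim: r => [|i r ih].
  by move: D0; congr D; apply/funext => z; rewrite big_nil.
have := D_lin (c i) (D_indic (mA i)) ih; congr D; apply/funext => z.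
by rewrite big_cons.
Qed.

Let D_nonneg (f : borel E -> R) : sq_integrable nu f -> (forall z, 0 <= f z) -> D f.
Proof.
move=> [mf if2] f0.
have mEf : measurable_fun setT (EFin \o f) by exact/measurable_EFinP.
pose f_ := nnsfun_approx measurableT mEf.
have Ef0 z : setT z -> (0 <= (EFin \o f) z)%E by move=> _; rewrite lee_fin.
have f_cvg z : f_ n z @[n --> \oo] --> f z.
  have := cvg_nnsfun_approx measurableT mEf Ef0 (I : setT z).
  by move=> /fine_cvg.
have f_le n z : f_ n z <= f z.
  by rewrite -lee_fin /f_ nnsfun_approxE; exact: le_approx.
apply: (D_dom (f_ := fun n => f_ n) (g := f)) => //.
- move=> n.
  have -> : (f_ n : E -> R) = _ := funext (fimfunEord (f_ n)).
  by apply: D_simple => i; exact: measurable_sfunP.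
- by move=> n z; rewrite ger0_norm//.
Qed.

(** Dynkin's lemma for the pi-system [trig_set] gives indicators of Borel sets,
    linearity gives simple functions, and domination by [f] or [|f|] gives
    every square-integrable [f] through its positive and negative parts. *)
Lemma sq_integrable_trig_ind (f : borel E -> R) : sq_integrable nu f -> D f.
Proof.
move=> [mf if2].
have mp : measurable_fun setT (f ^\+) by exact: measurable_funrpos.
have mn : measurable_fun setT (f ^\-) by exact: measurable_funrneg.
have le_abs : sq_integrable nu (fun z => `|f z|).
  split; first exact: measurableT_comp.
  suff -> : (fun z => `|f z| ^+ 2) = (fun z => f z ^+ 2) by [].
  by apply/funext => z; rewrite real_normK ?num_real.
have Dp : D (f ^\+).
  apply: D_nonneg => [|z]; last exact: funrpos_ge0.
  apply: sq_integrable_le le_abs => // z.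
  by rewrite ger0_norm ?funrpos_ge0// /funrpos ge_max ler_norm normr_ge0.
have Dn : D (f ^\-).
  apply: D_nonneg => [|z]; last exact: funrneg_ge0.
  apply: sq_integrable_le le_abs => // z.
  by rewrite ger0_norm ?funrneg_ge0// /funrneg ge_max -normrN ler_norm normr_ge0.
have := D_lin (-1) Dn Dp; congr D; apply/funext => z.
by rewrite mulN1r addrC -[RHS]/((f : borel E -> R) z) -[in RHS](funrposBneg f).
Qed.

End density.

(** * Bochner integrals against functionals *)

Section bochner_functional.
Context d (T : measurableType d) (R : realType).
Variable mu : {measure set T -> \bar R}.

(** Monotonicity without measurability: the integral of a nonnegative function
    is defined as a lower integral. *)
Lemma le_lower_integral (D : set T) (f1 f2 : T -> \bar R) :
  (forall x, D x -> 0 <= f1 x)%E -> (forall x, D x -> f1 x <= f2 x)%E ->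
  (\int[mu]_(x in D) f1 x <= \int[mu]_(x in D) f2 x)%E.
Proof.
move=> f10 f12; rewrite !ge0_integralE//; last first.
  by move=> x Dx; exact: le_trans (f10 x Dx) (f12 x Dx).
apply: ereal_sup_le => _ [h hf <-]; exists h => // x.
apply: (le_trans (hf x)).
by rewrite !patchE; case: ifPn => // /set_mem Dx; exact: f12.
Qed.

Context {E : normedModType R}.

Lemma integrable_indic_lty (D A : set T) : measurable D -> measurable A ->
  (mu (D `&` A) < +oo)%E -> mu.-integrable D (EFin \o \1_A).
Proof.
move=> mD mA DA; apply/integrableP; split; first exact/measurable_EFinP.
under eq_integral do rewrite /= ger0_norm//.
by rewrite integral_indic// setIC.
Qed.

Lemma Rintegral_sum (D : set T) (I : Type) (r : seq I) (f : I -> T -> R) :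
  measurable D -> (forall i, mu.-integrable D (EFin \o f i)) ->
  mu.-integrable D (EFin \o (fun s => \sum_(i <- r) f i s)) /\
  \int[mu]_(s in D) \sum_(i <- r) f i s = \sum_(i <- r) \int[mu]_(s in D) f i s.
Proof.
move=> mD fi; elim: r => [|i r [ih1 ih2]].
  under eq_Rintegral do rewrite big_nil.
  rewrite big_nil Rintegral_cst// mul0r; split=> //.
  by under eq_fun do rewrite big_nil; exact: integrable0.
have -> : (fun s => \sum_(j <- i :: r) f j s) =
    (fun s => f i s + \sum_(j <- r) f j s).
  by apply/funext => s; rewrite big_cons.
split; first exact: (integrableD mD (fi i) ih1).
by rewrite RintegralD// ih2 big_cons.
Qed.

(** The value [0] is harmless: its preimage may have infinite measure, but a
    functional vanishes there. *)
Lemma simple_vfun_functional (D : set T) (phi : T -> E) (y : dual E) :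
  measurable D -> simple_vfun mu D phi ->
  [/\ measurable_fun setT (fun s => y (phi s) : R),
      mu.-integrable D (fun s => (y (phi s) : R)%:E)
    & \int[mu]_(s in D) (y (phi s) : R) = y (simple_vint mu D phi)].
Proof.
move=> mD [fin_phi mphi phi_lty].
pose r : seq E := finmap.enum_fset (fset_set (range phi)).
pose A w := phi @^-1` [set w].
have phiE : (fun s => y (phi s) : R) = (fun s => \sum_(w <- r) (y w : R) * \1_(A w) s).
  apply/funext => s; have sr : phi s \in r.
    suff : phi s \in fset_set (range phi) by [].
    by rewrite in_fset_set// mem_set//; exists s.
  rewrite (bigD1_seq (phi s))//= ?fset_uniq// indicE mem_set// mulr1 big1 ?addr0// => w ws.
  by rewrite indicE memNset ?mulr0// => /= /esym/eqP; rewrite (negbTE ws).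
have fi w : mu.-integrable D (EFin \o (fun s => (y w : R) * \1_(A w) s)).
  have [->|w0] := eqVneq w 0.
    have -> : (fun s => (y 0 : R) * \1_(A 0) s) = cst 0.
      by apply/funext => s; rewrite linear0 mul0r.
    exact: integrable0.
  have iA : mu.-integrable D (EFin \o \1_(A w)).
    by apply: integrable_indic_lty => //; [exact: mphi|exact: phi_lty].
  exact: (integrableZl mD (y w : R) iA).
have [isum Isum] := Rintegral_sum r mD fi.
split.
- rewrite phiE; apply: measurable_sum => w.
  by apply: measurable_funM => //; apply: measurable_indic; exact: mphi.
- rewrite -[X in _.-integrable _ X]/(EFin \o (fun s => y (phi s) : R)).
  by rewrite phiE.
- rewrite phiE Isum /simple_vint fsbig_finite//= linear_sum/=.
  apply: eq_bigr => w _; rewrite linearZ /= /GRing.scale/= [RHS]mulrC.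
  have [->|w0] := eqVneq w 0.
    under eq_Rintegral do rewrite linear0 mul0r.
    by rewrite linear0 mul0r Rintegral_cst// mul0r.
  rewrite RintegralZl//; last first.
    by apply: integrable_indic_lty => //; [exact: mphi|exact: phi_lty].
  congr (_ * _); rewrite /Rintegral integral_indic//; last exact: mphi.
  by rewrite setIC.
Qed.

(** Functionals commute with Bochner integrals: the defining approximation of
    [f] by simple functions is carried by [y] to an L^1 approximation of
    [y (f s)]. *)
Lemma bochner_functional (D : set T) (f : T -> E) (v : E) (y : dual E) :
  measurable D -> is_bochner_integral mu D f v ->
  measurable_fun D (fun s => y (f s) : R) ->
  mu.-integrable D (fun s => (y (f s) : R)%:E) /\
  \int[mu]_(s in D) (y (f s) : R) = y v.
Proof.
move=> mD [phi [phis _ phi0 phiv]] mg.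
have [C C0 yC] := dual_bounded y.
pose g s : R := y (f s); pose h n s : R := y (phi n s).
have hs n := simple_vfun_functional y mD (phis n).
have mh n : measurable_fun D (h n).
  by have [m _ _] := hs n; exact: measurable_funTS m.
have ih n : mu.-integrable D (EFin \o h n) by have [] := hs n.
have mgh n : measurable_fun D (fun s => g s - h n s) by exact: measurable_funB.
have le_int n : (\int[mu]_(s in D) `|g s - h n s|%:E <=
    C%:E * \int[mu]_(s in D) `|f s - phi n s|%:E)%E.
  rewrite -lee_pdivrMl// -ge0_integralZl//; last 2 first.
  - by apply/measurable_EFinP; exact: measurableT_comp.
  - by rewrite lee_fin invr_ge0 ltW.
  apply: le_lower_integral => s _.
    by rewrite mule_ge0// lee_fin invr_ge0 ltW.
  by rewrite -EFinM lee_fin ler_pdivrMl// /g /h -linearB.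
have cvg0 : (\int[mu]_(s in D) `|g s - h n s|%:E)%E @[n --> \oo] --> 0%E.
  apply: (@squeeze_cvge _ _ _ _ (cst 0%E) _
    (fun n => C%:E * \int[mu]_(s in D) `|f s - phi n s|%:E)%E).
  - by apply: nearW => n; rewrite le_int andbT integral_ge0.
  - exact: cvg_cst.
  - by rewrite -[X in _ --> X](mule0 C%:E); apply: cvgeZl.
have igh : exists n, mu.-integrable D (EFin \o (fun s => g s - h n s)).
  have /fine_cvgP[[N _ /(_ N (leqnn _)) finN] _] := cvg0.
  exists N; apply/integrableP; split; first exact/measurable_EFinP.
  by rewrite ltey_eq finN.
have ig : mu.-integrable D (EFin \o g).
  have [n ighn] := igh.
  have := integrableD mD ighn (ih n); apply: eq_integrable => // s _.
  by rewrite /= -EFinD subrK.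
split=> //.
have cvgI : \int[mu]_(s in D) h n s @[n --> \oo] --> \int[mu]_(s in D) g s.
  apply/subr_cvg0; apply: norm_cvg0.
  have f0 : fine (\int[mu]_(s in D) `|g s - h n s|%:E)%E @[n --> \oo] --> (0 : R).
    exact: fine_cvg cvg0.
  apply: (@squeeze_cvgr _ _ _ _ (cst 0) _ _ _ _ _ f0); last exact: cvg_cst.
  apply: nearW => n; rewrite /= normr_ge0/= distrC -RintegralB//.
  apply: le_normr_Rintegral => //.
  exact: (integrableB mD ig (ih n)).
have cvgy : \int[mu]_(s in D) h n s @[n --> \oo] --> (y v : R).
  have := cvg_comp _ _ phiv (@bop_continuous _ _ _ y v).
  apply: cvg_trans; apply: near_eq_cvg; apply: nearW => n /=.
  by have [_ _] := hs n.
exact: cvg_unique cvgI cvgy.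
Qed.

End bochner_functional.

(** * Functions of a real variable *)

Section real_variable.
Context {R : realType}.
Local Notation leb := (@lebesgue_measure R).

(** [F r r] is the limit of [F (q n r) r], where [q n r] takes countably many
    values and tends to [r] from the right. *)
Lemma measurable_separately_right_continuous (F : R -> R -> R) :
  (forall u v, F u' v @[u' --> u^'+] --> F u v) ->
  (forall u, measurable_fun setT (F u)) ->
  measurable_fun setT (fun r => F r r).
Proof.
move=> Frc mF.
pose q (n : nat) (r : R) : R := (Num.floor (n.+1%:R * r) + 1)%:~R / n.+1%:R.
have q_gt n r : r < q n r.
  by rewrite /q ltr_pdivlMr// mulrC floorD1_gt.
have q_le n r : q n r <= r + n.+1%:R^-1.
  by rewrite /q ler_pdivrMr// mulrDl mulVf// rmorphD/= lerD2r mulrC floor_le.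
apply: (@measurable_fun_cvg _ _ R setT (fun n r => F (q n r) r)) => [n|r _].
  move=> _ B mB; rewrite setTI.
  have -> : (fun r => F (q n r) r) @^-1` B =
      \bigcup_(k in [set: int]) ([set r | Num.floor (n.+1%:R * r) = k] `&`
        F ((k + 1)%:~R / n.+1%:R) @^-1` B).
    apply/seteqP; split=> [r /= Br|r [k _ [/= <-]]]; last by [].
    by exists (Num.floor (n.+1%:R * r)).
  rewrite bigcup_mkcond; apply: countable_bigcupT_measurable => // k.
  case: ifP => // _; apply: measurableI.
    have -> : [set r : R | Num.floor (n.+1%:R * r) = k] =
        `[k%:~R / n.+1%:R, (k + 1)%:~R / n.+1%:R[%classic.
      apply/seteqP; split=> r /=; rewrite in_itv/= ler_pdivrMr// ltr_pdivlMr//.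
        by move=> <-; rewrite [r * _]mulrC floor_le floorD1_gt.
      by rewrite [r * _]mulrC => h; exact: floor_def.
    exact: measurable_itv.
  by rewrite -[X in measurable X]setTI; apply: mF.
move/cvg_at_rightP : (Frc r r); apply; split=> //.
apply: (@squeeze_cvgr _ _ _ _ (cst r) (fun n => r + n.+1%:R^-1)).
- by apply: nearW => n; rewrite ltW//= q_le.
- exact: cvg_cst.
- rewrite -[X in _ --> X]addr0; apply: cvgD; first exact: cvg_cst.
  exact: cvg_harmonic.
Qed.

Lemma measurable_right_continuous (f : R -> R) :
  (forall u, f u' @[u' --> u^'+] --> f u) -> measurable_fun setT f.
Proof.
move=> frc; apply: (@measurable_separately_right_continuous (fun u _ => f u)) => u.
  by move=> _; exact: frc.
exact: measurable_cst.
Qed.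

Lemma lebesgue_measure_shift (a : R) (A : set R) : measurable A ->
  pushforward leb (fun r : R => (r - a : measurableTypeR R)) A = leb A.
Proof.
move=> mA.
have mshift : measurable_fun setT (fun r : R => (r - a : measurableTypeR R)).
  exact: measurable_funB.
apply/esym/(@lebesgue_measure_unique _
  (pushforward leb (fun r : R => (r - a : measurableTypeR R)))) => //.
move=> _ [[c b]] _ <-; transitivity (leb `]c + a, b + a]%classic).
  rewrite !lebesgue_measure_itv/= !lte_fin ltrD2r; case: ifP => // _.
  by rewrite -!EFinD; congr EFin; ring.
rewrite /= /pushforward; congr (leb _).
by apply/seteqP; split=> r; rewrite /= !in_itv/= ltrBrDr lerBlDr.
Qed.

Lemma integral_shift (f : R -> R) (a t : R) : 0 <= a -> 0 <= t ->
  measurable_fun setT f -> leb.-integrable `[0, a + t] (EFin \o f) ->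
  leb.-integrable `[0, t] (EFin \o (fun r => f (a + r))) /\
  \int[leb]_(r in `[0, a + t]) f r =
  \int[leb]_(r in `[0, a]) f r + \int[leb]_(r in `[0, t]) f (a + r).
Proof.
move=> a0 t0 mf intf.
pose phi (r : measurableTypeR R) : measurableTypeR R := r - a.
pose f' (r : measurableTypeR R) : R := f (a + r).
have mphi : measurable_fun setT phi by exact: measurable_funB.
have mf' : measurable_fun setT (EFin \o f').
  apply/measurable_EFinP; apply: (measurableT_comp mf).
  exact: measurable_funD.
pose I : set (measurableTypeR R) := `[0, t]%classic.
have preD : phi @^-1` I = `[a, a + t]%classic.
  by apply/seteqP; split=> r; rewrite /I /phi /= !in_itv/= subr_ge0 lerBlDr [t + _]addrC.
have f'phi : (EFin \o f') \o phi = EFin \o f.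
  by apply/funext => r; rewrite /= /f' /phi [a + _]addrC subrK.
have int2 : leb.-integrable `[a, a + t] (EFin \o f).
  apply: integrableS intf => //.
  by move=> r; rewrite /= !in_itv/= => /andP[ar ->]; rewrite andbT (le_trans a0).
have int2' : leb.-integrable (phi @^-1` I) ((EFin \o f') \o phi).
  by rewrite preD f'phi.
have shiftE (g : R -> \bar R) :
    (\int[pushforward leb phi]_(r in I) g r = \int[leb]_(r in I) g r)%E.
  by apply: eq_measure_integral => A mA _; exact: lebesgue_measure_shift.
split.
  have /integrableP[_ lty] := integrable_pushforward mphi mf' int2' (measurable_itv _).
  apply/integrableP; split; first exact: measurable_funTS mf'.
  by move: lty; rewrite shiftE.
have -> : `[0, a + t]%classic = `[0, a]%classic `|` `]a, a + t]%classic :> set R.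
  by rewrite -itv_bndbnd_setU// bnd_simp// lerDl.
rewrite Rintegral_setU//; last 2 first.
- by rewrite -itv_bndbnd_setU// bnd_simp// lerDl.
- apply/disj_setPS => r []; rewrite /= !in_itv/= => /andP[_ ra] /andP[ar _].
  by move: ar; rewrite ltNge ra.
congr (_ + _); rewrite Rintegral_itv_obnd_cbnd; last first.
  apply: integrableS int2 => //.
  by move=> r; rewrite /= !in_itv/= => /andP[/ltW -> ->].
rewrite /Rintegral; congr fine.
rewrite -shiftE (integral_pushforward mphi mf' int2' (measurable_itv _)).
by rewrite preD f'phi.
Qed.

(** By Lebesgue's differentiation theorem [f] is almost everywhere the
    derivative of its primitive. *)
Lemma primitive_eq0 (f : R -> R) (T : R) : measurable_fun setT f ->
  (forall t, 0 < t -> leb.-integrable `[0, t] (EFin \o f)) ->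
  (forall t, 0 < t -> \int[leb]_(r in `[0, t]) f r = 0) ->
  {ae leb, forall r, 0 < r < T -> f r = 0}.
Proof.
move=> mf intf f0.
have [T0|T0] := leP T 0.
  by apply: aeW => r /andP[r0 rT]; have := lt_trans r0 rT; rewrite ltNge T0.
pose g := f \_ `[0, T].
have locg : locally_integrable setT g.
  by apply: integrable_locally => //; exact: intf.
have intg (y : R) : leb.-integrable `[0, y] (EFin \o g).
  apply: (integrableS measurableT) => //; rewrite /g -restrict_EFin.
  by apply/(integrable_mkcond _ _).1 => //; exact: intf.
have := FTC1 intg locg.
apply: filterS; first exact: (ae_filter_ringOfSetsType leb).
move=> r h /andP[r0 rT].
have gr : g r = f r by rewrite /g patchE mem_set//= in_itv/= !ltW.
have [|_ F'r] := h; first by rewrite /= lte_fin.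
transitivity (g r); first exact/esym.
rewrite -F'r.
have m0 : 0 < Num.min r (T - r) by rewrite lt_min r0 subr_gt0.
apply/cvg_lim => //; apply: cvg_near_cst; near=> u.
suff I0 w : 0 < w < T -> \int[leb]_(x in `[0, w]) g x = 0.
  have um : `|u| < Num.min r (T - r).
    by near: u; apply: dnbhs0_lt; exact: m0.
  move: um; rewrite lt_min !ltr_norml => /andP[/andP[u1 u2] /andP[u3 u4]].
  rewrite !I0 ?r0 ?rT//; first by rewrite subrr scaler0.
  by apply/andP; split; lra.
move=> /andP[w0 wT]; rewrite -[RHS](f0 w w0); apply: eq_Rintegral => x /set_mem.
rewrite /= in_itv/= => /andP[x0 xw].
by rewrite /g patchE mem_set//= in_itv/= x0 (le_trans xw) ?ltW.
Unshelve. all: by end_near. Qed.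

End real_variable.

(** * The covariance form and its evolution *)

Section right_limits.
Context {R : realType}.
Local Notation leb := (@lebesgue_measure R).

Lemma cvg_subr_at_right (u : R) : u' - u @[u' --> u^'+] --> (0 : R)^'+.
Proof.
move=> P [e /= e0 eP]; exists e => // r /= ur ru.
apply: eP => /=; last by rewrite subr_gt0.
by rewrite sub0r normrN -normrN opprB.
Qed.

Lemma right_limit_eq0 (h : R -> R) (w : R) : h u @[u --> w^'+] --> h w ->
  (forall d, 0 < d -> exists2 u, w < u < w + d & h u = 0) -> h w = 0.
Proof.
move=> hw zeros; apply/eqP/negPn/negP => hw0.
have n0 : 0 < `|h w| by rewrite normr_gt0.
have /cvgrPdist_lt/(_ _ n0)[e /= e0 eh] := hw.
have [u /andP[wu ue] hu] := zeros _ e0.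
suff : `|h w - h u| < `|h w| by rewrite hu subr0 ltxx.
apply: eh => //=.
by rewrite distrC gtr0_norm ?subr_gt0// ltrBlDl.
Qed.

Lemma ae_exists_small (P : R -> Prop) (T : R) :
  {ae leb, forall r, 0 < r < T -> P r} -> forall d, 0 < d -> 0 < T ->
  exists2 r, 0 < r < d & P r.
Proof.
move=> [N [mN N0 PN]] d d0 T0; apply: contrapT => /forall2NP noP.
have m0 : 0 < Num.min d T by rewrite lt_min d0.
have sub : `]0, Num.min d T[%classic `<=` N.
  move=> r; rewrite /= in_itv/= lt_min => /andP[r0 /andP[rd rT]].
  apply: PN => /= h; have [nr|nP] := noP r; first by apply: nr; rewrite r0 rd.
  by apply: nP; apply: h; rewrite r0 rT.
have : (leb `]0%R, Num.min d T[%classic <= leb N)%E.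
  by apply: le_measure => //; apply: mem_set; [exact: measurable_itv|exact: mN].
rewrite [X in (_ <= X)%E]N0 lebesgue_measure_itv/= lte_fin m0 oppr0 adde0.
by rewrite lee_fin leNgt m0.
Qed.

End right_limits.

Section covariance_form.
Context {R : realType} {E : normedModType R} {H : completeNormedModType R}.
Context {ip : H -> H -> R} (hip : hilbert_inner ip) (i : bounded_op H E).
Local Notation Q := (factor_cov ip i).
Implicit Types x y : dual E.

Lemma hilbert_adjointP x h : ip (hilbert_adjoint ip i x) h = x (i h).
Proof.
have [g gP] := riesz_representation hip (adjoint_op i x).
rewrite /hilbert_adjoint.
by have /= := @getPex _ [set h | forall k, ip h k = x (i k)] (ex_intro _ g gP).
Qed.

Lemma factor_cov_form x y :
  y (Q x) = ip (hilbert_adjoint ip i x) (hilbert_adjoint ip i y).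
Proof. by rewrite [RHS](ipC hip) hilbert_adjointP. Qed.

Lemma factor_cov_sym x y : y (Q x) = x (Q y).
Proof. by rewrite !factor_cov_form (ipC hip). Qed.

(** Functionals are compared pointwise: the record [dual E] also carries a
    continuity proof. *)
Lemma factor_cov_ext x x' : (forall z, x z = x' z) -> Q x = Q x'.
Proof.
move=> xx'; rewrite /factor_cov /hilbert_adjoint; congr (i (get _)).
by apply/seteqP; split=> h /= hP k; rewrite hP xx'.
Qed.

End covariance_form.

Section semigroup_orbits.
Context {R : realType} {E : normedModType R}.
Variable S : R -> bounded_op E E.
Hypothesis hS : C0_semigroup S.

Lemma semigroup0 z : S 0 z = z.
Proof. by case: hS. Qed.

Lemma semigroupD s t z : 0 <= s -> 0 <= t -> S (s + t) z = S s (S t z).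
Proof. by move=> s0 t0; case: hS => _ + _; apply. Qed.

Lemma semigroupC s t z : 0 <= s -> 0 <= t -> S s (S t z) = S t (S s z).
Proof. by move=> s0 t0; rewrite -!semigroupD// addrC. Qed.

Lemma orbit_right_cvg u z : 0 <= u -> S u' z @[u' --> u^'+] --> S u z.
Proof.
move=> u0; case: hS => _ _ S0.
have h := cvg_comp _ _ (cvg_subr_at_right u) (S0 (S u z)).
apply: cvg_trans h; apply: near_eq_cvg; near=> u' => /=.
have uu' : u < u' by near: u'; exact: nbhs_right_gt.
by rewrite -semigroupD ?subr_ge0 ?(ltW uu')// subrK.
Unshelve. all: by end_near. Qed.

Lemma functional_orbit_right_cvg (y : dual E) u z : 0 <= u ->
  (y (S u' z) : R) @[u' --> u^'+] --> (y (S u z) : R).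
Proof.
move=> u0.
have h := cvg_comp _ _ (@orbit_right_cvg u z u0) (@bop_continuous _ _ _ y (S u z)).
exact: h.
Qed.

Lemma functional_orbit_max_right_cvg (y : dual E) u z :
  (y (S (Num.max u' 0) z) : R) @[u' --> u^'+] --> (y (S (Num.max u 0) z) : R).
Proof.
have [u0|u0] := leP 0 u.
  apply: cvg_trans (@functional_orbit_right_cvg y u z u0).
  apply: near_eq_cvg; near=> u'.
  have uu' : u < u' by near: u'; exact: nbhs_right_gt.
  by rewrite (max_idPl (le_trans u0 (ltW uu'))).
apply: cvg_near_cst; near=> u'.
have u'0 : u' < 0 by near: u'; exact: nbhs_right_lt.
by rewrite (max_idPr (ltW u'0)).
Unshelve. all: by end_near. Qed.

End semigroup_orbits.

Section evolution.
Context {R : realType} {E : completeNormedModType R} {S : R -> bounded_op E E}.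
Context {H : completeNormedModType R} {ip : H -> H -> R} {i : bounded_op H E}.
Context {Qt : R -> dual E -> E} {Qoo : dual E -> E}.
Local Notation leb := (@lebesgue_measure R).
Local Notation Q := (factor_cov ip i).
Local Notation "S^* t" := (adjoint_op (S t)) (at level 10, t at level 9).
Implicit Types x y : dual E.

Hypothesis hS : C0_semigroup S.
Hypothesis hip : hilbert_inner ip.
Hypothesis hQt : forall t : R, 0 < t -> forall x : dual E,
  is_bochner_integral lebesgue_measure `[0, t]
    (fun s : R => S s (Q (S^* s x))) (Qt t x).
Hypothesis hQoo : forall x : dual E, weak_limit (fun t => Qt t x) (Qoo x).
Hypothesis Qoo_ext : forall x x' y y' : dual E, (forall z, x z = x' z) ->
  (forall z, y z = y' z) -> y (Qoo x) = y' (Qoo x').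

(** The density of [t |-> y (Q_t x)]; the positive part makes it a function
    on the whole line. *)
Definition cov_density x y (r : R) : R :=
  y (S (Num.max r 0) (Q (S^* (Num.max r 0) x))).

Lemma cov_densityE x y r : 0 <= r -> cov_density x y r = y (S r (Q (S^* r x))).
Proof. by move=> r0; rewrite /cov_density (max_idPl r0). Qed.

(** Strong continuity of [S] gives right-continuity in the time of the outer
    [S], and, as [Q] is symmetric, also in the time of the inner [S^*]. *)
Lemma measurable_cov_density x y : measurable_fun setT (cov_density x y).
Proof.
pose F (u v : R) : R := y (S (Num.max u 0) (Q (S^* (Num.max v 0) x))).
apply: (@measurable_separately_right_continuous _ F) => [u v|u].
  exact: functional_orbit_max_right_cvg.
apply: measurable_right_continuous => v.
have FE w : F u w = x (S (Num.max w 0) (Q (S^* (Num.max u 0) y))).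
  exact: (factor_cov_sym hip i (S^* (Num.max w 0) x) (S^* (Num.max u 0) y)).
rewrite FE; under eq_fun do rewrite FE.
exact: functional_orbit_max_right_cvg.
Qed.

Lemma Qt_integral t x y : 0 < t ->
  leb.-integrable `[0, t] (EFin \o cov_density x y) /\
  \int[leb]_(r in `[0, t]) cov_density x y r = y (Qt t x).
Proof.
move=> t0.
have eq_on : {in `[0, t]%classic, cov_density x y =1
    (fun r => y (S r (Q (S^* r x))) : R)}.
  by move=> r /set_mem; rewrite /= in_itv/= => /andP[r0 _]; rewrite cov_densityE.
have mg : measurable_fun `[0, t] (fun r => y (S r (Q (S^* r x))) : R).
  apply: (eq_measurable_fun (cov_density x y)) => //.
  exact: measurable_funTS (measurable_cov_density x y).
have [ig Ig] := @bochner_functional _ _ R leb E _ _ _ y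
  (measurable_itv `[0, t]) (hQt t0 x) mg.
split; last by rewrite -Ig; exact: eq_Rintegral.
by apply: eq_integrable ig => // r /eq_on /= ->.
Qed.

Lemma cov_density_shift x y a r : 0 <= a -> 0 <= r ->
  cov_density x y (a + r) = cov_density (S^* a x) (S^* a y) r.
Proof.
move=> a0 r0; rewrite !cov_densityE ?addr_ge0//= semigroupD//.
rewrite (@factor_cov_ext _ _ _ ip i _ (S^* r (S^* a x)))// => z /=.
by rewrite semigroupD.
Qed.

Lemma Qt_add a t x y : 0 < a -> 0 < t ->
  y (Qt (a + t) x) = y (Qt a x) + y (S a (Qt t (S^* a x))) :> R.
Proof.
move=> a0 t0.
have [iat <-] := Qt_integral x y (addr_gt0 a0 t0).
have [_ ->] := integral_shift (ltW a0) (ltW t0) (measurable_cov_density x y) iat.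
have [_ ->] := Qt_integral x y a0.
have [_ h] := Qt_integral (S^* a x) (S^* a y) t0.
congr (_ + _); rewrite -[RHS]h; apply: eq_Rintegral => r /set_mem.
by rewrite /= in_itv/= => /andP[r0 _]; rewrite cov_density_shift// ltW.
Qed.

(** The weak limit of [Q_(t + s) = Q_t + S(t) Q_s S^*(t)] as [s] tends to
    infinity. *)
Lemma Qoo_decomposition t x y : 0 < t ->
  y (Qoo x) = y (Qt t x) + y (S t (Qoo (S^* t x))) :> R.
Proof.
move=> t0.
have h1 : (y (Qt (t + s) x) : R) @[s --> +oo] --> (y (Qoo x) : R).
  apply: (@cvg_comp _ _ _ (fun s => t + s) (fun s => y (Qt s x) : R)).
    exact: cvg_addrl.
  exact: hQoo.
have h2 : (y (Qt t x) : R) + (S^* t y (Qt s (S^* t x)) : R) @[s --> +oo] -->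
    (y (Qt t x) : R) + (S^* t y (Qoo (S^* t x)) : R).
  by apply: cvgD; [exact: cvg_cst|exact: hQoo].
apply: (cvg_unique _ h1) => //; apply: cvg_trans h2; apply: near_eq_cvg.
near=> s => /=; have s0 : 0 < s by near: s; exact: nbhs_pinfty_gt.
by rewrite Qt_add.
Unshelve. all: by end_near. Qed.

(** [S t] intertwines with every integrand [S(s) Q S^*(s)], since the [S(s)]
    commute with it. *)
Lemma Q_to_Qoo_symmetric t : 0 <= t ->
  (forall x, S t (Q x) = Q (S^* t x)) ->
  forall x y, y (Qoo (S^* t x)) = y (S t (Qoo x)) :> R.
Proof.
move=> t0 Qsym x y.
have h1 : (y (Qt r (S^* t x)) : R) @[r --> +oo] --> (y (Qoo (S^* t x)) : R).
  exact: hQoo.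
have h2 : (S^* t y (Qt r x) : R) @[r --> +oo] --> (S^* t y (Qoo x) : R).
  exact: hQoo.
apply: (cvg_unique _ h1) => //; apply: cvg_trans h2; apply: near_eq_cvg.
near=> r => /=.
have r0 : 0 < r by near: r; exact: nbhs_pinfty_gt.
have [_ <-] := Qt_integral (S^* t x) y r0.
have [_ h] := Qt_integral x (S^* t y) r0; rewrite -[LHS]h.
apply: eq_Rintegral => s /set_mem; rewrite /= in_itv/= => /andP[s0 _].
rewrite !cov_densityE//= semigroupC// Qsym.
congr (y (S s _) : R); apply: factor_cov_ext => z /=.
by rewrite semigroupC.
Unshelve. all: by end_near. Qed.

(** The values of the form of [Q S^*(s) - S(s) Q] along two orbits. *)
Definition cov_gap x y (s u v : R) : R :=
  y (S v (Q (S^* s (S^* u x)))) - y (S v (S s (Q (S^* u x)))).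

Lemma cov_gap_right_cvgr x y s u v : 0 <= v ->
  cov_gap x y s u v' @[v' --> v^'+] --> cov_gap x y s u v.
Proof. by move=> v0; apply: cvgB; exact: functional_orbit_right_cvg. Qed.

(** The symmetry of [Q] moves the inner orbit outside. *)
Lemma cov_gap_right_cvgl x y s u v : 0 <= u ->
  cov_gap x y s u' v @[u' --> u^'+] --> cov_gap x y s u v.
Proof.
move=> u0.
have gapE w : cov_gap x y s w v =
    x (S w (S s (Q (S^* v y)))) - x (S w (Q (S^* s (S^* v y)))).
  by congr (_ - _); [exact: (factor_cov_sym hip i _ (S^* v y))
                    |exact: (factor_cov_sym hip i _ (S^* s (S^* v y)))].
rewrite gapE; under eq_fun do rewrite gapE.
by apply: cvgB; exact: functional_orbit_right_cvg.
Qed.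

Section Qoo_symmetric.
Hypothesis Qoosym : forall t, 0 <= t ->
  forall x y, y (Qoo (S^* t x)) = y (S t (Qoo x)) :> R.

(** [Q_t] is a difference of two operators that intertwine [S s] and
    [S^* s]. *)
Lemma Qt_symmetric s t x y : 0 <= s -> 0 < t ->
  y (Qt t (S^* s x)) = y (S s (Qt t x)) :> R.
Proof.
move=> s0 t0.
have := Qoo_decomposition (S^* s x) y t0.
have /= := Qoo_decomposition x (S^* s y) t0.
rewrite Qoosym// => ->.
have -> : y (S t (Qoo (S^* t (S^* s x)))) = y (S s (S t (Qoo (S^* t x)))) :> R.
  transitivity (S^* t y (Qoo (S^* s (S^* t x))) : R).
    by apply: (@Qoo_ext _ _ (S^* t y)) => // z /=; rewrite (semigroupC hS)// ltW.
  by rewrite Qoosym//= (semigroupC hS)// ltW.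
by move=> /addIr ->.
Qed.

(** The diagonal gap is the density of [Q_t S^*(s) - S(s) Q_t = 0]. *)
Lemma cov_gap_diag_ae x y s : 0 <= s ->
  {ae leb, forall r, 0 < r < 1 -> cov_gap x y s r r = 0}.
Proof.
move=> s0.
pose f r := cov_density (S^* s x) y r - cov_density x (S^* s y) r.
have mf : measurable_fun setT f.
  by apply: measurable_funB; exact: measurable_cov_density.
have h t : 0 < t -> leb.-integrable `[0, t] (EFin \o f) /\
    \int[leb]_(r in `[0, t]) f r = 0.
  move=> t0.
  have [i1 I1] := Qt_integral (S^* s x) y t0.
  have [i2 I2] := Qt_integral x (S^* s y) t0.
  have mI : measurable (`[0, t]%classic : set (measurableTypeR R)).
    exact: measurable_itv.
  split; first exact: (integrableB mI i1 i2).
  by rewrite RintegralB// I1 I2 Qt_symmetric//= subrr.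
have := primitive_eq0 1 mf (fun t t0 => (h t t0).1) (fun t t0 => (h t t0).2).
apply: filterS; first exact: (ae_filter_ringOfSetsType leb).
move=> r fr /andP[r0 r1]; rewrite -(fr _) ?r0// /f /cov_gap.
rewrite !cov_densityE ?ltW//=; congr (_ - _).
  congr (y (S r _) : R); apply: factor_cov_ext => z /=.
  by rewrite (semigroupC hS)// ltW.
by rewrite (semigroupC hS)// ltW.
Qed.

(** Replacing [y] by [S^* q y] moves the diagonal to [(r, r + q)]; one null set
    serves all rational [q], and right-continuity in the second time fills the
    half-line. *)
Lemma cov_gap_ae x y s : 0 <= s ->
  {ae leb, forall r, 0 < r < 1 -> forall w, r <= w -> cov_gap x y s r w = 0}.
Proof.
move=> s0.
pose q (n : nat) : R := ratr (odflt 0 (choice.unpickle n : option rat)).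
have qae n : {ae leb, forall r, 0 <= q n -> 0 < r < 1 -> cov_gap x y s r (r + q n) = 0}.
  have [q0|qn] := leP 0 (q n); last first.
    exact: aeW.
  have := cov_gap_diag_ae x (S^* (q n) y) s0.
  apply: filterS; first exact: (ae_filter_ringOfSetsType leb).
  move=> r h _ r01; have /andP[r0 _] := r01; rewrite -[RHS](h r01) /cov_gap /=.
  by rewrite [r + _]addrC !(semigroupD hS) ?(ltW r0).
have := ae_foralln qae; apply: filterS => r h r01 w rw; have /andP[r0 _] := r01.
apply: (right_limit_eq0 (h := cov_gap x y s r)).
  exact: cov_gap_right_cvgr (le_trans (ltW r0) rw).
move=> d d0; have [p] : exists p : rat, ratr p \in `](w - r), (w - r + d)[.
  by apply: rat_in_itvoo; rewrite ltrDl.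
rewrite in_itv/= => /andP[p1 p2]; exists (r + ratr p).
  by apply/andP; split; lra.
have qp : q (choice.pickle p) = ratr p by rewrite /q choice.pickleK.
by rewrite -qp; apply: h => //; rewrite qp; lra.
Qed.

(** The gap is [0] at [(r, w)] for almost every small [r] and all [w >= r];
    let [r], then [w], decrease to [0]. *)
Lemma Qoo_to_Q_symmetric s : 0 <= s -> forall x, S s (Q x) = Q (S^* s x).
Proof.
move=> s0 x; apply: dual_separates => y.
have gap0w w : 0 < w -> cov_gap x y s 0 w = 0.
  move=> w0; apply: (right_limit_eq0 (h := fun u => cov_gap x y s u w)).
    exact: cov_gap_right_cvgl.
  move=> d d0; have m0 : 0 < Num.min d w by rewrite lt_min d0.
  have [r /andP[r0]] := ae_exists_small (cov_gap_ae x y s0) m0 ltr01.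
  rewrite lt_min => /andP[rd rw] hr; exists r; first by rewrite r0 add0r.
  exact/hr/ltW.
have gap00 : cov_gap x y s 0 0 = 0.
  apply: (right_limit_eq0 (h := cov_gap x y s 0)).
    exact: cov_gap_right_cvgr.
  move=> d d0; exists (d / 2); last by apply: gap0w; rewrite divr_gt0.
  by apply/andP; split; lra.
move/eqP : gap00; rewrite /cov_gap !(semigroup0 hS) subr_eq0 => /eqP.
have E0 : forall z, S^* 0 x z = x z by move=> z /=; rewrite (semigroup0 hS).
rewrite (factor_cov_ext i E0) => <-; congr (y _).
by apply: factor_cov_ext => z /=; rewrite (semigroup0 hS).
Qed.

End Qoo_symmetric.

End evolution.

(** * Functionals under a centred Gaussian measure *)

Section gaussian_functionals.
Context {R : realType} {E : normedModType R} (nu : probability (borel E) R).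
Hypothesis gauss : centred_gaussian nu.
Implicit Types x y : dual E.

Lemma gaussian_sq_integrable x : sq_integrable nu (x : borel E -> R).
Proof.
have [s lawx] := gauss x; have [ix _] := centred_normal_variance (measurable_dual x) lawx.
by split; first exact: measurable_dual.
Qed.

Lemma gaussian_cos x th :
  \int[nu]_z cos (x z + th) = cos th * expR (- (\int[nu]_z (x z * x z)) / 2).
Proof.
have [s lawx] := gauss x; have [_ ->] := centred_normal_variance (measurable_dual x) lawx.
have := centred_normal_cos (measurable_dual x) lawx 1 th; rewrite expr1n mul1r => <-.
by apply: eq_Rintegral => z _; rewrite mul1r.
Qed.

End gaussian_functionals.

(** * Square-integrable functions and classes *)

Section square_integrable.
Context d (T : measurableType d) (R : realType) (mu : {measure set T -> \bar R}).
Implicit Types f g h : T -> R.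

Lemma sq_integrable_mul f g : sq_integrable mu f -> sq_integrable mu g ->
  mu.-integrable setT (EFin \o (fun x => f x * g x)).
Proof.
move=> [mf if2] [mg ig2].
apply: (@le_integrable _ _ _ mu _ measurableT _ _ _ _ (integrableD measurableT if2 ig2)).
  by apply/measurable_EFinP; exact: measurable_funM.
move=> x _ /=; rewrite lee_fin normrM.
rewrite [leRHS]ger0_norm ?addr_ge0 ?sqr_ge0//.
rewrite -(real_normK (num_real (f x))) -(real_normK (num_real (g x))).
have := normr_ge0 (f x); have := normr_ge0 (g x); move: `|f x| `|g x| => a b; nra.
Qed.

Lemma sq_integrable_lin (a : R) f g : sq_integrable mu f -> sq_integrable mu g ->
  sq_integrable mu (fun x => a * f x + g x).
Proof.
move=> sf sg; have [mf if2] := sf; have [mg ig2] := sg.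
have ifg := sq_integrable_mul sf sg.
split; first by apply: measurable_funD => //; exact: measurable_funM.
have := integrableD measurableT (integrableZl measurableT (a ^+ 2) if2)
  (integrableD measurableT (integrableZl measurableT (2 * a) ifg) ig2).
apply: eq_integrable => // x _; rewrite /= -!EFinM -!EFinD; congr EFin; ring.
Qed.

(** Cauchy-Schwarz, from the nonnegativity of the integral of [(a f + b g)^2]. *)
Lemma cauchy_schwarz f g : sq_integrable mu f -> sq_integrable mu g ->
  (\int[mu]_x (f x * g x)) ^+ 2 <= \int[mu]_x (f x ^+ 2) * \int[mu]_x (g x ^+ 2).
Proof.
move=> sf sg; have [mf if2] := sf; have [mg ig2] := sg.
have ifg := sq_integrable_mul sf sg.
set A := \int[mu]_x (f x ^+ 2); set B := \int[mu]_x (g x ^+ 2).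
set C := \int[mu]_x (f x * g x).
have A0 : 0 <= A by apply: Rintegral_ge0 => x _; exact: sqr_ge0.
have B0 : 0 <= B by apply: Rintegral_ge0 => x _; exact: sqr_ge0.
have quad (a b : R) : 0 <= a ^+ 2 * A + 2 * a * b * C + b ^+ 2 * B.
  have : 0 <= \int[mu]_x ((a * f x + b * g x) ^+ 2).
    by apply: Rintegral_ge0 => x _; exact: sqr_ge0.
  have -> : \int[mu]_x ((a * f x + b * g x) ^+ 2) =
      \int[mu]_x (a ^+ 2 * f x ^+ 2 + (2 * a * b * (f x * g x) + b ^+ 2 * g x ^+ 2)).
    by apply: eq_Rintegral => x _; ring.
  have i1 := integrableZl measurableT (a ^+ 2) if2.
  have i2 := integrableZl measurableT (2 * a * b) ifg.
  have i3 := integrableZl measurableT (b ^+ 2) ig2.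
  rewrite (RintegralD measurableT i1 (integrableD measurableT i2 i3)).
  rewrite (RintegralD measurableT i2 i3).
  by rewrite (RintegralZl _ measurableT if2) (RintegralZl _ measurableT ifg)
    (RintegralZl _ measurableT ig2) addrA.
have [A0'|Ale] := ltP 0 A.
  have := quad C (- A).
  rewrite (_ : _ + _ = A * (A * B - C ^+ 2)); last by ring.
  by rewrite pmulr_rge0// subr_ge0.
have A00 : A = 0 by apply/le_anti; rewrite Ale.
have [->|C0] := eqVneq C 0; first by rewrite expr0n mulr_ge0.
have := quad (- (B + 1) / (2 * C)) 1; rewrite A00.
rewrite (_ : _ + _ = - 1); last by field.
by rewrite oppr_ge0 ler10.
Qed.

Lemma sq_integrable_ae f g : sq_integrable mu f -> measurable_fun setT g ->
  ae_eq mu setT f g -> sq_integrable mu g.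
Proof.
move=> [mf /integrableP[mf2 if2]] mg fg; split=> //.
have mg2 : measurable_fun setT (EFin \o (fun x => g x ^+ 2)).
  by apply/measurable_EFinP; exact: measurable_funX.
apply/integrableP; split=> //.
pose f2 := abse \o (EFin \o (fun x => f x ^+ 2)).
pose g2 := abse \o (EFin \o (fun x => g x ^+ 2)).
suff -> : (\int[mu]_x g2 x = \int[mu]_x f2 x)%E by [].
apply: ae_eq_integral => //.
- exact: measurableT_comp.
- exact: measurableT_comp.
- by apply: filterS fg => x h /h; rewrite /f2 /g2 /= => ->.
Qed.

End square_integrable.

Section L2_classes.
Context d (T : measurableType d) (R : realType) (mu : probability T R).
Implicit Types F G K : L2 mu.

Lemma sq_integrable_finite_norm (f : T -> R) : sq_integrable mu f ->
  finite_norm mu 2%:E f.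
Proof.
move=> [mf /integrableP[mf2 if2]].
rewrite /finite_norm unlock poweR_lty//.
apply: le_lt_trans if2; rewrite le_eqVlt; apply/orP; left; apply/eqP.
by apply: eq_integral => x _ /=; rewrite normrX powR_mulrn.
Qed.

Lemma L2_sq_integrable F : sq_integrable mu F.
Proof.
have mF : measurable_fun setT F by exact: measurable_funPT.
split=> //; apply: Lfun2_integrable_sqr.
rewrite inE; apply/andP; split; rewrite inE//=.
exact: Lebesgue_finite.
Qed.

Lemma ex_L2_class (f : T -> R) : sq_integrable mu f ->
  exists F : L2 mu, ae_eq mu setT F f.
Proof.
move=> sf; have [mf _] := sf.
pose fm : {mfun T >-> measurableTypeR R} := HB.pack f
  (isMeasurableFun.Build _ _ T (measurableTypeR R) f mf).
pose c : {mfun_ mu, T >-> measurableTypeR R} := (\pi fm)%qT.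
have cf : ae_eq mu setT c f.
  have : (repr c == fm %[mod {mfun_ mu, T >-> measurableTypeR R}])%qT.
    by rewrite reprK.
  rewrite eqmodE => /asboolP.
  by apply: filterS => x h _; rewrite -[RHS]/(fm x) -h.
have sc : sq_integrable mu c.
  apply: (sq_integrable_ae sf); first exact: (measurable_funPT (repr c)).
  exact: ae_eq_sym.
pose Fc := isFinLebesgue.Build _ T R mu 2%:E (lee1n 2) c (sq_integrable_finite_norm sc).
pose F : L2 mu := HB.pack c Fc.
by exists F.
Qed.

Lemma L2norm_sqr F : L2norm F ^+ 2 = \int[mu]_x (F x ^+ 2).
Proof.
have two0 : (2 : R) != 0 by [].
have := powR_Lnorm mu (EFin \o F) two0.
have N0 : (0 <= 'N[mu]_2%:E[EFin \o F])%E by exact: Lnorm_ge0.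
have Nfin : ('N[mu]_2%:E[EFin \o F])%E \is a fin_num.
  by rewrite ge0_fin_numE//; exact: Lebesgue_finite.
rewrite /L2norm -(fineK Nfin) poweR_EFin.
rewrite -[2 in X in X = _ -> _]/(2%:R) powR_mulrn ?fine_ge0// => h.
rewrite /Rintegral -(_ : (\int[mu]_x (`|(EFin \o F) x| `^ 2))%E =
  (\int[mu]_x (F x ^+ 2)%:E)%E).
  by rewrite -h.
by apply: eq_integral => x _ /=; rewrite powR_mulrn// real_normK// num_real.
Qed.

End L2_classes.

(** * Operators on L^2 determined by trigonometric functions *)

Section L2_operators.
Context {R : realType} {E : normedModType R} (nu : probability (borel E) R).
Hypothesis Esep : separable E.
Implicit Types F G K : L2 nu.

Lemma L2innerC F G : L2inner F G = L2inner G F.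
Proof. by apply: eq_Rintegral => z _; rewrite mulrC. Qed.

Lemma eq_L2inner (f g f' g' : borel E -> R) :
  sq_integrable nu f -> sq_integrable nu g ->
  measurable_fun setT f' -> measurable_fun setT g' ->
  ae_eq nu setT f f' -> ae_eq nu setT g g' ->
  \int[nu]_z (f z * g z) = \int[nu]_z (f' z * g' z).
Proof.
move=> [mf _] [mg _] mf' mg' ff' gg'; rewrite /Rintegral; congr fine.
apply: ae_eq_integral => //.
- by apply/measurable_EFinP; exact: measurable_funM.
- by apply/measurable_EFinP; exact: measurable_funM.
- by apply: filterS2 ff' gg' => z h1 h2 _; rewrite h1// h2.
Qed.

Lemma L2inner_lin (a : R) F G K (M : L2 nu) :
  ae_eq nu setT M (fun z => a * F z + G z) ->
  L2inner M K = a * L2inner F K + L2inner G K.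
Proof.
move=> MFG; have sF := L2_sq_integrable F; have sG := L2_sq_integrable G.
have sK := L2_sq_integrable K; have sFG := sq_integrable_lin a sF sG.
rewrite /L2inner (eq_L2inner (f' := fun z => a * F z + G z) (g' := K)
  (L2_sq_integrable M) sK sFG.1 sK.1 MFG (ae_eq_refl _ _ _)).
have iFK := sq_integrable_mul sF sK; have iGK := sq_integrable_mul sG sK.
rewrite -(RintegralZl _ measurableT iFK).
rewrite -(RintegralD measurableT (integrableZl measurableT a iFK) iGK).
by apply: eq_Rintegral => z _; ring.
Qed.

(** A bounded linear functional of the form [F |-> (A F, K1) - (F, K2)] that
    vanishes on trigonometric functions is zero, for it is continuous. *)
Lemma L2_functional_eq (A : L2 nu -> L2 nu) K1 K2 :
  L2linear A -> (forall F, L2norm (A F) <= L2norm F) ->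
  (forall (x : dual E) (th : R) F, ae_eq nu setT F (fun z => cos (x z + th)) ->
    L2inner (A F) K1 = L2inner F K2) ->
  forall F, L2inner (A F) K1 = L2inner F K2.
Proof.
move=> Alin Acon trigK F.
pose D (f : E -> R) := sq_integrable nu (f : borel E -> R) /\
  forall F, ae_eq nu setT F f -> L2inner (A F) K1 = L2inner F K2.
have sqA G : \int[nu]_z (A G z ^+ 2) <= \int[nu]_z (G z ^+ 2).
  rewrite -!L2norm_sqr ler_pXn2r ?nnegrE ?fine_ge0 ?Lnorm_ge0//.
suff : D F by case=> _; apply; exact: ae_eq_refl.
apply: (sq_integrable_trig_ind Esep (nu := nu) (D := D)); last exact: L2_sq_integrable.
- move=> x th; split; last exact: trigK.
  apply: (@sq_integrable_bounded _ _ _ nu _ 1).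
    exact: measurable_trig_poly (trig_cos x th).
  by move=> z; rewrite ler_norml cos_geN1 cos_le1.
- move=> a f g [sf Df] [sg Dg]; split; first exact: sq_integrable_lin.
  move=> M Mfg.
  have [F0 F0f] := ex_L2_class sf; have [G0 G0g] := ex_L2_class sg.
  have MFG : ae_eq nu setT M (fun z => a * F0 z + G0 z).
    by apply: filterS3 Mfg F0f G0g => z h1 h2 h3 _; rewrite h1// h2// h3.
  rewrite (L2inner_lin K2 MFG) (L2inner_lin K1 (Alin _ _ _ _ MFG)).
  by rewrite (Df _ F0f) (Dg _ G0g).
- move=> f_ f g Df_ ff sg fg.
  have mf : measurable_fun setT (f : borel E -> R).
    by apply: (@measurable_fun_cvg _ (borel E) R setT f_) => // n; have [[]] := Df_ n.
  have fle z : `|f z| <= g z.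
    have := ff z => /(cvg_norm) h.
    by apply: (cvgr_to_le h); apply: nearW => n; exact: fg.
  have sf : sq_integrable nu (f : borel E -> R).
    exact: sq_integrable_le mf fle sg.
  split=> // M Mf.
  pose e n (z : borel E) : R := -1 * f z + f_ n z.
  have sfn n : sq_integrable nu (e n) by apply: sq_integrable_lin => //; exact: (Df_ n).1.
  have norm0 : \int[nu]_z (e n z ^+ 2) @[n --> \oo] --> 0.
    have [||||_] := @Rintegral_dominated_cvg R _ _ nu setT (fun n z => e n z ^+ 2)
        (fun=> 0) (fun z => 4 * g z ^+ 2) measurableT.
    - by move=> n; have [me _] := sfn n; exact: measurable_funX.
    - move=> z _; rewrite -[X in _ --> X](mulr0 0).
      have e0 : e n z @[n --> \oo] --> 0.
        rewrite -[X in _ --> X](addNr (f z)); apply: cvgD; last exact: ff.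
        by rewrite mulN1r; exact: cvg_cst.
      by under eq_fun do rewrite expr2; exact: cvgM.
    - exact: (integrableZl measurableT 4 sg.2).
    - move=> n z _; rewrite normrX.
      have h1 : `|e n z| <= 2 * g z.
        rewrite /e mulN1r; apply: le_trans (ler_normD _ _) _; rewrite normrN.
        by have := fle z; have := fg n z; lra.
      have : `|e n z| ^+ 2 <= (2 * g z) ^+ 2.
        by rewrite ler_pXn2r ?nnegrE ?normr_ge0// (le_trans _ h1).
      by rewrite exprMn; lra.
    by rewrite Rintegral_cst// mul0r.
  (* The defect [delta] at the limit equals minus the defect of the class of
     [f_ n - f], which Cauchy-Schwarz bounds by its norm. *)
  set delta := L2inner (A M) K1 - L2inner M K2.
  pose C := \int[nu]_z (K2 z ^+ 2) + \int[nu]_z (K1 z ^+ 2).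
  have bound n : delta ^+ 2 <= 2 * C * \int[nu]_z (e n z ^+ 2).
    have [F0 F0f] := ex_L2_class (Df_ n).1; have [N Ne] := ex_L2_class (sfn n).
    have F0E : ae_eq nu setT F0 (fun z => 1 * N z + M z).
      by apply: filterS3 F0f Ne Mf => z h1 h2 h3 _; rewrite h1// h2// h3// /e; ring.
    have := (Df_ n).2 _ F0f.
    rewrite (L2inner_lin K2 F0E) (L2inner_lin K1 (Alin _ _ _ _ F0E)) !mul1r => h.
    have -> : delta = L2inner N K2 - L2inner (A N) K1 by rewrite /delta; lra.
    have NE : \int[nu]_z (N z ^+ 2) = \int[nu]_z (e n z ^+ 2).
      have sN := L2_sq_integrable N.
      have h2 := eq_L2inner sN sN (sfn n).1 (sfn n).1 Ne Ne.
      under eq_Rintegral do rewrite expr2.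
      by rewrite h2; apply: eq_Rintegral => z _; rewrite expr2.
    have := cauchy_schwarz (L2_sq_integrable N) (L2_sq_integrable K2).
    have := cauchy_schwarz (L2_sq_integrable (A N)) (L2_sq_integrable K1).
    have K10 : 0 <= \int[nu]_z (K1 z ^+ 2) by apply: Rintegral_ge0 => z _; exact: sqr_ge0.
    have := ler_wpM2r K10 (sqA N).
    rewrite -/(L2inner (A N) K1) -/(L2inner N K2) NE /C.
    have := sqr_ge0 (L2inner N K2 + L2inner (A N) K1); lra.
  apply/eqP; rewrite -subr_eq0 -/delta -sqrf_eq0 eq_le sqr_ge0 andbT.
  have lim0 : 2 * C * \int[nu]_z (e n z ^+ 2) @[n --> \oo] --> 0.
    by rewrite -[X in _ --> X](mulr0 (2 * C)); apply: cvgM; [exact: cvg_cst|exact: norm0].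
  by apply: (cvgr_to_ge lim0); apply: nearW.
Qed.

End L2_operators.

(** * The Ornstein-Uhlenbeck semigroup on trigonometric functions *)

Section gaussian_trig_inner.
Context {R : realType} {E : normedModType R} (nu : probability (borel E) R).
Hypothesis gauss : centred_gaussian nu.
Implicit Types x y : dual E.
Local Notation cov x y := (\int[nu]_z (x z * y z)).

Lemma cov_lin_sqr x y (a : R) :
  cov (dual_add x (dual_scale a y)) (dual_add x (dual_scale a y)) =
  cov x x + 2 * a * cov x y + a ^+ 2 * cov y y.
Proof.
have sx := gaussian_sq_integrable gauss x; have sy := gaussian_sq_integrable gauss y.
have ixx := sq_integrable_mul sx sx; have ixy := sq_integrable_mul sx sy.
have iyy := sq_integrable_mul sy sy.
have i2 := integrableZl measurableT (2 * a) ixy.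
have i3 := integrableZl measurableT (a ^+ 2) iyy.
rewrite -(RintegralZl _ measurableT ixy) -(RintegralZl _ measurableT iyy) -addrA.
rewrite -(RintegralD measurableT i2 i3).
rewrite -(RintegralD measurableT ixx (integrableD measurableT i2 i3)).
by apply: eq_Rintegral => z _ /=; rewrite /GRing.scale/=; ring.
Qed.

Lemma gaussian_trig_inner x y th et :
  \int[nu]_z (cos (x z + th) * cos (y z + et)) =
  2^-1 * expR (- (cov x x + cov y y) / 2) *
    (cos (th + et) * expR (- cov x y) + cos (th - et) * expR (cov x y)).
Proof.
pose p := dual_add x (dual_scale 1 y); pose m := dual_add x (dual_scale (-1) y).
have bounded_cos (w : dual E) (c : R) :
    nu.-integrable setT (EFin \o (fun z => cos (w z + c))).
  apply: (@integrable_bounded _ _ _ nu _ 1).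
    exact: measurable_trig_poly (trig_cos w c).
  by move=> z; rewrite ler_norml cos_geN1 cos_le1.
have -> : \int[nu]_z (cos (x z + th) * cos (y z + et)) =
    \int[nu]_z (2^-1 * (cos (p z + (th + et)) + cos (m z + (th - et)))).
  apply: eq_Rintegral => z _; rewrite cos_mul_cos /p /m /= /GRing.scale/=.
  by congr (_ * (cos _ + cos _)); ring.
have ip := bounded_cos p (th + et); have im := bounded_cos m (th - et).
rewrite (RintegralZl _ measurableT (integrableD measurableT ip im)).
rewrite (RintegralD measurableT ip im) !(gaussian_cos gauss) !cov_lin_sqr -[RHS]mulrA.
congr (_ * _); rewrite mulrDr [in RHS]mulrCA [X in _ = _ + X]mulrCA -!expRD.
by congr (_ * expR _ + _ * expR _); field.
Qed.

End gaussian_trig_inner.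

Section ornstein_uhlenbeck.
Context {R : realType} {E : completeNormedModType R} {S : R -> bounded_op E E}.
Context {Qt : R -> dual E -> E} {Qoo : dual E -> E}.
Context {mu : R -> probability (borel E) R} {muoo : probability (borel E) R}.
Context {P : R -> L2 muoo -> L2 muoo}.
Local Notation "S^* t" := (adjoint_op (S t)) (at level 10, t at level 9).
Implicit Types x y : dual E.

Hypothesis hmu : forall t : R, 0 < t ->
  centred_gaussian (mu t) /\ covariance_operator (mu t) (Qt t).
Hypothesis hmuoo : centred_gaussian muoo /\ covariance_operator muoo Qoo.
Hypothesis hP : ou_semigroup S mu P.
Hypothesis decomposition : forall t x y, 0 < t ->
  y (Qoo x) = y (Qt t x) + y (S t (Qoo (S^* t x))) :> R.

Lemma ou_trig t x th z : 0 < t ->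
  ou_fun S mu t (fun z => cos (x z + th)) z =
  expR (- (x (Qt t x) : R) / 2) * cos (x (S t z) + th).
Proof.
move=> t0; have [gauss cov] := hmu t0; rewrite /ou_fun mulrC cov.
rewrite -(gaussian_cos gauss); apply: eq_Rintegral => w _.
by rewrite linearD addrCA addrA.
Qed.

(** The factor [exp (- x(Q_t x) / 2)] of [ou_trig] completes the variance of
    [S^* t x] to that of [x], by the decomposition of [Q_oo]. *)
Lemma P_trig_inner t x y th et (F G : L2 muoo) : 0 < t ->
  ae_eq muoo setT F (fun z => cos (x z + th)) ->
  ae_eq muoo setT G (fun z => cos (y z + et)) ->
  L2inner (P t F) G =
  2^-1 * expR (- ((x (Qoo x) : R) + y (Qoo y)) / 2) *
    (cos (th + et) * expR (- (y (Qoo (S^* t x)) : R)) +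
     cos (th - et) * expR (y (Qoo (S^* t x)) : R)).
Proof.
move=> t0 Fx Gy; have [_ ouP] := hP; have [gauss cov] := hmuoo.
have mx : measurable_fun setT (fun z : borel E => cos (x z + th)).
  exact: measurable_trig_poly (trig_cos x th).
have mSx := measurable_trig_poly (trig_cos (S^* t x) th).
have my := measurable_trig_poly (trig_cos y et).
have bcos (w : R) : `|cos w| <= 1 by rewrite ler_norml cos_geN1 cos_le1.
have PF : ae_eq muoo setT (P t F) (fun z =>
    expR (- (x (Qt t x) : R) / 2) * cos (S^* t x z + th)).
  have bx : exists M : R, forall z : borel E, `|cos (x z + th)| <= M.
    by exists 1 => z; exact: bcos.
  have := ouP t (ltW t0) _ mx bx F Fx.
  by apply: filterS => z /[apply] ->; rewrite ou_trig.
have mPF : measurable_fun setT (fun z : borel E =>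
    expR (- (x (Qt t x) : R) / 2) * cos (S^* t x z + th)).
  exact: measurable_funM.
rewrite /L2inner (eq_L2inner (L2_sq_integrable (P t F)) (L2_sq_integrable G)
  mPF my PF Gy).
have iSxy : muoo.-integrable setT
    (EFin \o (fun z => cos (S^* t x z + th) * cos (y z + et))).
  apply: (@integrable_bounded _ _ _ muoo _ 1); first exact: measurable_funM.
  by move=> z; rewrite normrM mulr_ile1.
under eq_Rintegral do rewrite -mulrA.
rewrite (RintegralZl _ measurableT iSxy) (gaussian_trig_inner gauss) -!cov.
rewrite mulrA mulrCA -expRD; congr (_ * expR _ * _).
by rewrite (decomposition x x t0) /=; field.
Qed.

(** At the phases [th = et = pi / 4] only one exponential survives. *)
Lemma selfadjoint_Qoo_symmetric (hS0 : forall z, S 0 z = z) :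
  L2_selfadjoint_semigroup P ->
  forall t, 0 <= t -> forall x y, y (Qoo (S^* t x)) = y (S t (Qoo x)) :> R.
Proof.
have [gauss cov] := hmuoo.
move=> Psym t; rewrite le_eqVlt => /orP[/eqP <-|t0] x y.
  by rewrite hS0 !cov; apply: eq_Rintegral => z _ /=; rewrite hS0.
have phase (w : dual E) : exists F : L2 muoo,
    ae_eq muoo setT F (fun z => cos (w z + pi / 4)).
  apply: ex_L2_class; apply: (@sq_integrable_bounded _ _ _ muoo _ 1).
    exact: measurable_trig_poly (trig_cos w (pi / 4)).
  by move=> z; rewrite ler_norml cos_geN1 cos_le1.
have [F Fx] := phase x; have [G Gy] := phase y.
have := Psym t (ltW t0) F G; rewrite [RHS]L2innerC.
rewrite (P_trig_inner t0 Fx Gy) (P_trig_inner t0 Gy Fx).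
have -> : pi / 4 + pi / 4 = pi / 2 :> R by field.
rewrite subrr cos_pihalf cos0 !mul0r !add0r !mul1r [y (Qoo y) + _]addrC.
move/mulfI => /(_ _)/expR_inj -> //; last first.
  by rewrite mulf_neq0 ?invr_eq0// gt_eqF// expR_gt0.
rewrite -[RHS]/(S^* t y (Qoo x)) !cov.
by apply: eq_Rintegral => z _; rewrite mulrC.
Qed.

(** The formula of [P_trig_inner] is now symmetric; it extends to L^2 in one
    argument after the other. *)
Lemma Qoo_symmetric_selfadjoint : separable E ->
  (forall t, 0 <= t -> forall x y, y (Qoo (S^* t x)) = y (S t (Qoo x)) :> R) ->
  L2_selfadjoint_semigroup P.
Proof.
move=> Esep Qsym t; rewrite le_eqVlt => /orP[/eqP <-|t0] F G.
  by have [[_ _ P0 _ _] _] := hP; rewrite !P0.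
have [[Plin Pcon _ _ _] _] := hP; have [gauss cov] := hmuoo.
have {}Plin := Plin t (ltW t0); have {}Pcon := Pcon t (ltW t0).
have trig x y th et (F0 G0 : L2 muoo) :
    ae_eq muoo setT F0 (fun z => cos (x z + th)) ->
    ae_eq muoo setT G0 (fun z => cos (y z + et)) ->
    L2inner (P t F0) G0 = L2inner F0 (P t G0).
  move=> Fx Gy; rewrite [RHS]L2innerC (P_trig_inner t0 Fx Gy) (P_trig_inner t0 Gy Fx).
  have -> : y (Qoo (S^* t x)) = x (Qoo (S^* t y)) :> R.
    rewrite (Qsym t (ltW t0)) -[LHS]/(S^* t y (Qoo x)) !cov.
    by apply: eq_Rintegral => z _; rewrite mulrC.
  rewrite [et + th]addrC -(opprB th) cosN [y (Qoo y) + _]addrC.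
  by [].
apply: (L2_functional_eq Esep Plin Pcon) => x th F0 Fx.
rewrite L2innerC [RHS]L2innerC; apply/esym.
apply: (L2_functional_eq Esep Plin Pcon) => y et G0 Gy.
exact: trig Gy Fx.
Qed.

End ornstein_uhlenbeck.

Theorem theorem7p4 (R : realType)
    (E : completeNormedModType R) (S : R -> bounded_op E E)
    (H : completeNormedModType R) (ip : H -> H -> R) (i : bounded_op H E)
    (Qt : R -> dual E -> E) (Qoo : dual E -> E)
    (mu : R -> probability (borel E) R) (muoo : probability (borel E) R)
    (P : R -> L2 muoo -> L2 muoo)
    (hsep : separable E)
    (hS : C0_semigroup S)
    (hip : hilbert_inner ip)
    (hi : injective i)
    (hQt : forall t : R, 0 < t -> forall x : dual E,
       is_bochner_integral lebesgue_measure `[0, t]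
         (fun s : R => S s (factor_cov ip i (adjoint_op (S s) x))) (Qt t x))
    (hmu0 : forall A : set (borel E), measurable A -> mu 0 A = \d_((0 : E) : borel E) A)
    (hmu : forall t : R, 0 < t ->
       centred_gaussian (mu t) /\ covariance_operator (mu t) (Qt t))
    (hQoo : forall x : dual E, weak_limit (fun t => Qt t x) (Qoo x))
    (hmuoo : centred_gaussian muoo /\ covariance_operator muoo Qoo)
    (hP : ou_semigroup S mu P) :
  L2_selfadjoint_semigroup P <->
  (forall t : R, 0 <= t -> forall x : dual E,
     S t (factor_cov ip i x) = factor_cov ip i (adjoint_op (S t) x)).
Proof.
have [gauss cov] := hmuoo.
have Qoo_ext (x x' y y' : dual E) : (forall z, x z = x' z) ->
    (forall z, y z = y' z) -> y (Qoo x) = y' (Qoo x').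
  move=> xx' yy'; rewrite !cov; apply: eq_Rintegral => z _.
  by rewrite xx' yy'.
have dec t x y (t0 : 0 < t) := Qoo_decomposition hS hip hQt hQoo x y t0.
split=> [Psym|Qsym].
- apply: (Qoo_to_Q_symmetric hS hip hQt hQoo Qoo_ext).
  exact: selfadjoint_Qoo_symmetric hmu hmuoo hP dec (semigroup0 hS) Psym.
- apply: (Qoo_symmetric_selfadjoint hmu hmuoo hP dec hsep) => t t0.
  exact: (Q_to_Qoo_symmetric hS hip hQt hQoo t0 (Qsym t t0)).
Qed.
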